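(* Let $n\ge 1$, let $f:\mathbb{C}^{n+1}\to\mathbb{R}$ be a smooth function, let $M=\{z: f(z)=0\}$ be the boundary of $\{z: f(z)<0\}$, and assume $\nabla f\ne 0$ on $M$. Then the classical mean curvature $\mathcal{H}^M$, the Levi mean curvature $\mathcal{L}^M$ and the characteristic curvature $\mathcal{C}^M$ of $M$ (all taken with respect to the unit normal $N=-\nabla f/|\nabla f|$) satisfy, at every point of $M$, $$(2n+1)\,\mathcal{H}^M = 2n\,\mathcal{L}^M+\mathcal{C}^M .$$
   Context: Identify $\mathbb{C}^{n+1}\cong\mathbb{R}^{n+1}\times\mathbb{R}^{n+1}$ with points $z=(x,y)$, $z_k\simeq(x_k,y_k)$, let $g$ be the standard Euclidean scalar product (extended complex-bilinearly to complexified vectors), $\nabla$ its Levi-Civita connection, and let $J=\begin{pmatrix}0&I_{n+1}\\-I_{n+1}&0\end{pmatrix}$ be the complex structure (which is also the canonical symplectic matrix). Let $N=-\nabla f/|\nabla f|$ and let $T=-J(N)=J\nabla f/|\nabla f|\in TM$ be the characteristic direction. The Levi distribution is $HM=TM\cap J(TM)$, of real dimension $2n$; one has the orthogonal decomposition $TM=HM\oplus\mathbb{R}T$. The second fundamental form is $h(V,W)=g(\nabla_VW,N)$ for $V,W\in TM$, and $\mathcal{H}^M=\frac{1}{2n+1}\operatorname{tr}(h)$ is the classical mean curvature (trace with respect to $g$ on $TM$). The Levi form is the hermitian form $l(Z_1,\bar Z_2)=g(\nabla_{Z_1}\bar Z_2,N)$, where $Z_j=X_j-iJ(X_j)$ with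 $X_j\in HM$. The Levi mean curvature is $\mathcal{L}^M=\frac1n\operatorname{tr}(l)$, the trace being taken with respect to the hermitian inner product $(Z,W)\mapsto g(Z,\bar W)$ on the $n$-dimensional complex space $\{X-iJ(X): X\in HM\}$. The characteristic curvature at $z\in M$ is $$\mathcal{C}^M_z=\frac{g(\ddot\gamma(0),N_z)}{|\dot\gamma(0)|^2},$$ where $\gamma:(-\varepsilon,\varepsilon)\to M$ is any smooth curve with $\gamma(0)=z$ and $\dot\gamma(0)\in K_z\setminus\{0\}$, where $K_z=\{\xi\in T_zM:\omega(v,\xi)=0\ \forall v\in T_zM\}$, $\omega=\sum_{k=1}^{n+1}dy_k\wedge dx_k$. *)

(* Defs.v *)
From HB Require Import structures.
From mathcomp Require Import all_boot all_order all_algebra.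
From mathcomp Require Import complex.
From mathcomp Require Import all_classical all_reals all_analysis.

Set Implicit Arguments.
Unset Strict Implicit.
Unset Printing Implicit Defensive.

Import Order.TTheory GRing.Theory Num.Theory.
Import numFieldNormedType.Exports.

Local Open Scope classical_set_scope.
Local Open Scope ring_scope.
Local Open Scope complex_scope.

Section Smoothness.
Context {R : realType}.

(* For U finite dimensional and A open this is the usual class C^k(A; V):
   having all directional derivatives of class C^(k-1) is the same as having
   all partial derivatives of class C^(k-1). *)
Fixpoint Ck_on (U V : normedModType R) (k : nat) (A : set U) (f : U -> V)
    : Prop :=
  if k is k'.+1 then
    (forall p, A p -> differentiable f p) /\
    (forall v, Ck_on k' A ('D_v f))
  else forall p, A p -> {for p, continuous f}.

Definition smooth_on (U V : normedModType R) (A : set U) (f : U -> V) :=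
  forall k, Ck_on k A f.

End Smoothness.

Section Traces.
Context {K : fieldType} {V : lmodType K}.

Definition orthonormal_basis (ip : V -> V -> K) (S : set V)
    (k : nat) (e : 'I_k -> V) : Prop :=
  [/\ forall i, S (e i),
      forall i j, ip (e i) (e j) = (i == j)%:R
    & forall v, S v -> exists c : 'I_k -> K, v = \sum_i c i *: e i].

(* [b] is a bilinear or sesquilinear form on the subspace [S]; the value does
   not depend on the orthonormal basis, so it is simply picked. *)
Definition trace_wrt (ip : V -> V -> K) (S : set V) (b : V -> V -> K) : K :=
  xget 0 [set t | exists k (e : 'I_k -> V),
    orthonormal_basis ip S e /\ t = \sum_i b (e i) (e i)].

End Traces.

(* C^(n+1) is the space of columns (x, y), with x and y the upper and lower
   halves. The matrix norm `| _ | of the library is the sup norm: it is used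
   only through the topology, the Euclidean norm being [enorm]. *)
Notation vec K n := 'cV[K]_(n.+1 + n.+1).

(* Over R[i] this is the complex-bilinear extension, not a hermitian form. *)
Definition g {K : comPzRingType} {n : nat} (v w : vec K n) : K :=
  \sum_i v i 0 * w i 0.

Section Hypersurface.
Context {R : realType} {n : nat}.
Implicit Types (f : vec R n -> R) (z p v w xi : vec R n).

Definition enorm v : R := Num.sqrt (g v v).

Definition J : 'M[R]_(n.+1 + n.+1) := block_mx 0 1%:M (- 1%:M) 0.

(* omega = \sum_k dy_k /\ dx_k *)
Definition omega v w : R :=
  \sum_(k < n.+1) (dsubmx v k 0 * usubmx w k 0 - dsubmx w k 0 * usubmx v k 0).

Definition grad f z : vec R n := \col_i 'D_(delta_mx i 0) f z.

Definition hypersurface f : set (vec R n) := [set z | f z = 0].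

Definition unit_normal f z : vec R n := - ((enorm (grad f z))^-1 *: grad f z).

(* The distributions below are meant at points of [hypersurface f], where
   [grad f] does not vanish. *)
Definition tangent f z : set (vec R n) := [set v | g (grad f z) v = 0].

Definition levi_distribution f z : set (vec R n) :=
  tangent f z `&` [set J *m v | v in tangent f z].

(* W is a smooth vector field near z which, along the hypersurface, is a
   section of the distribution D. *)
Definition local_section f (D : vec R n -> set (vec R n)) z
    (W : vec R n -> vec R n) : Prop :=
  exists U : set (vec R n), [/\ open U, U z, smooth_on U W &
    forall p, U p -> hypersurface f p -> D p (W p)].

(* The Levi-Civita connection of the flat metric g. *)
Definition nabla (V W : vec R n -> vec R n) (p : vec R n) : vec R n :=
  'D_(V p) W p.

(* h_z(v, w) is the common value of g (nabla_V W, N) at z over all tangent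
   fields V, W extending v, w. *)
Definition second_fundamental_form f z v w : R :=
  xget 0 [set r | exists V W : vec R n -> vec R n,
    [/\ local_section f (tangent f) z V, local_section f (tangent f) z W,
        V z = v, W z = w & r = g (nabla V W z) (unit_normal f z)]].

Definition mean_curvature f z : R :=
  (2 * n + 1)%:R^-1 *
  trace_wrt g (tangent f z) (second_fundamental_form f z).

(* The complex vector v + i w. *)
Definition cvec v w : vec R[i] n := \col_j (v j 0 +i* w j 0).
Definition re_vec (Z : vec R[i] n) : vec R n := \col_j complex.Re (Z j 0).
Definition im_vec (Z : vec R[i] n) : vec R n := \col_j complex.Im (Z j 0).
Definition conj_vec (Z : vec R[i] n) : vec R[i] n := \col_j (Z j 0)^*.

(* The complex-bilinear extension of [nabla]. *)
Definition nablaC (Z W : vec R n -> vec R[i] n) (p : vec R n) : vec R[i] n :=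
  let ReZ q := re_vec (Z q) in let ImZ q := im_vec (Z q) in
  let ReW q := re_vec (W q) in let ImW q := im_vec (W q) in
  cvec (nabla ReZ ReW p - nabla ImZ ImW p) (nabla ReZ ImW p + nabla ImZ ReW p).

Definition holo v : vec R[i] n := cvec v (- (J *m v)).

Definition holo_tangent f z : set (vec R[i] n) :=
  [set holo v | v in levi_distribution f z].

(* [levi_form f z Z1 Z2] is l(Z1, conj Z2), for Z1, Z2 in [holo_tangent f z]. *)
Definition levi_form f z (Z1 Z2 : vec R[i] n) : R[i] :=
  xget 0 [set r | exists X1 X2 : vec R n -> vec R n,
    [/\ local_section f (levi_distribution f) z X1,
        local_section f (levi_distribution f) z X2,
        holo (X1 z) = Z1, holo (X2 z) = Z2 &
        r = g (nablaC (fun p => holo (X1 p))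
                      (fun p => conj_vec (holo (X2 p))) z)
              (cvec (unit_normal f z) 0)]].

(* Complex-valued by construction; that it is real is not built in. *)
Definition levi_mean_curvature f z : R[i] :=
  n%:R^-1 *
  trace_wrt (fun Z W => g Z (conj_vec W)) (holo_tangent f z) (levi_form f z).

Definition characteristic_space f z : set (vec R n) :=
  [set xi | tangent f z xi /\ forall v, tangent f z v -> omega v xi = 0].

Definition characteristic_curve f z (gamma : R -> vec R n) : Prop :=
  exists2 e : R, 0 < e &
    [/\ smooth_on `]- e, e[%classic gamma,
        forall t, t \in `]- e, e[ -> hypersurface f (gamma t),
        gamma 0 = z,
        characteristic_space f z (gamma^`()%classic 0)
      & gamma^`()%classic 0 != 0].

(* The common value over all such curves. *)
Definition characteristic_curvature f z : R :=
  xget 0 [set c | exists gamma : R -> vec R n,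
    characteristic_curve f z gamma /\
    c = g (gamma^`(2)%classic 0) (unit_normal f z) / enorm (gamma^`()%classic 0) ^+ 2].

End Hypersurface.

(* Main.v *)
Require Import Defs.
From mathcomp Require Import all_boot all_order all_algebra.
From mathcomp Require Import complex.
From mathcomp Require Import all_classical all_reals all_analysis.
From mathcomp Require Import ring lra.
Import Order.TTheory GRing.Theory Num.Theory.
Import numFieldNormedType.Exports.
Local Open Scope classical_set_scope.
Local Open Scope ring_scope.
Local Open Scope complex_scope.

(** All three curvatures are values of the Hessian of [f] divided by the norm
of [grad f z]. Write [d] for [grad f z] and [M] for the Hessian matrix.

Differentiating along the hypersurface the identity [g (grad f) W = 0], valid
for a tangent field [W], shows that the normal component of the derivative of
[W] along a tangent vector [v] is [hess f z v (W z) / enorm d] (lemma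
[weingarten]). Hence
- the second fundamental form is [hess f z] on the tangent space
  ([second_fundamental_formE]);
- the Levi form at [holo x] is the sum of the values of the Hessian at [x] and
  at [J *m x] ([levi_formE]), the imaginary part being zero by the symmetry of
  the Hessian ([derive_comm]);
- the characteristic curvature is the value of the Hessian at the unit vector
  in the direction [J *m d] ([characteristic_curvatureE]), by differentiating
  twice [f] along a curve.

The tangent space is the orthogonal complement of [d], so the trace of the
second fundamental form is [\tr M] minus the normal term [g d (M *m d) / g d d]
([mean_curvatureE]). The Levi distribution is the orthogonal complement of [d]
and [J *m d], so the trace of the Levi form, doubled, is this number minus the
term of [J *m d] ([levi_mean_curvatureE]), which is the characteristic
curvature.

The values above are those of arbitrary sections, orthonormal bases and curves,
so the three numbers also need these objects to exist. Sections are explicit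
([tangent_section], [levi_section]), bases are orthonormal families of maximal
size ([orthonormal_basis_exists]), and a smooth characteristic curve comes from
the implicit function theorem ([implicit_function], [level_curve]): the implicit
function is found with the intermediate value theorem, and its smoothness
follows from the differential equation that it satisfies. *)

(** * Smooth functions *)

Section SmoothnessCalculus.
Context {R : realType}.

Lemma near_eq_differentiable (U V : normedModType R) (f h : U -> V) (p : U) :
  (\near p, f p = h p) -> differentiable f p -> differentiable h p.
Proof.
move=> fh df; have e0 : differentiable (h - f) p.
  have H : (h - f) \o shift p = cst ((h - f) p) + \0 +o_ 0 id.
    have fh0 : \forall x \near 0, f (x + p) = h (x + p).
      move: fh; rewrite (near_shift 0 p).
      by apply: filterS => x /=; rewrite subr0.
    apply/eqaddoP => e e0; near=> x.
    have fhx : f (x + p) = h (x + p) by near: x.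
    have fhp : f p = h p := nbhs_singleton fh.
    rewrite [X in `|X|](_ : _ = 0) ?normr0 ?mulr_ge0// ?ltW//.
    rewrite !fctE /= -[X in X - _]/(h (x + p) - f (x + p)).
    by rewrite -[X in _ - (X + _)]/(h p - f p) fhx fhp !subrr addr0 subrr.
  apply/diff_locallyP.
  have -> : 'd (h - f) p = \0 :> (U -> V).
    by apply: (diff_unique _ H); exact: cst_continuous.
  by split=> //; exact: cst_continuous.
rewrite (_ : h = f + (h - f)); first exact: differentiableD.
by apply/funext => x; rewrite !fctE addrC subrK.
Unshelve. all: by end_near. Qed.

Lemma open_near_eq {U : normedModType R} {V : Type} {A : set U} {f h : U -> V}
  {p : U} : open A -> (forall q, A q -> f q = h q) -> A p -> \near p, f p = h p.
Proof. by move=> oA fh Ap; apply: filterS (open_nbhs_nbhs (conj oA Ap)). Qed.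

(** Every closure property below computes a directional derivative, and the
formula obtained for it is valid on [A] only: off [A] the derivative of a
function that need not be differentiable is an arbitrary value. This lemma
transports regularity along such an equality. *)
Lemma Ck_on_ext (U V : normedModType R) k (A : set U) (f h : U -> V) :
  open A -> (forall p, A p -> f p = h p) -> Ck_on k A f -> Ck_on k A h.
Proof.
move=> oA; elim: k f h => [|k IH] f h fh /=.
  move=> cf p Ap; have -> : {for p, continuous h} = (h x @[x --> p] --> f p).
    by rewrite (fh p Ap).
  apply: cvg_trans (cf p Ap).
  by apply: near_eq_cvg; exact: (open_near_eq oA fh Ap).
move=> [df Df]; split=> [p Ap|v].
  by apply: near_eq_differentiable (df p Ap); exact: open_near_eq oA _ Ap.
apply: IH (Df v) => p Ap; apply: near_eq_derive; exact: open_near_eq oA _ Ap.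
Qed.

Lemma Ck_onW (U V : normedModType R) k (A : set U) (f : U -> V) :
  Ck_on k.+1 A f -> Ck_on k A f.
Proof.
elim: k f => [|k IH] f /= [df Df].
  by move=> p Ap; exact/differentiable_continuous/df.
by split=> // v; apply: IH; exact: Df.
Qed.

Lemma Ck_on_cst (U V : normedModType R) k (A : set U) (c : V) :
  Ck_on k A (cst c : U -> V).
Proof.
elim: k c => [|k IH] c /=; first by move=> p _; exact: cst_continuous.
split=> [p _|v]; first exact: differentiable_cst.
by rewrite (_ : 'D_v _ = cst 0)//; apply/funext => p; exact: derive_cst.
Qed.

Section Scalar.
Context {U : normedModType R} {A : set U}.
Hypothesis oA : open A.
Implicit Types f h : U -> R.

Lemma Ck_onD k f h :
  Ck_on k A f -> Ck_on k A h -> Ck_on k A (fun p => f p + h p).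
Proof.
elim: k f h => [|k IH] f h /=.
  by move=> cf ch p Ap; apply: continuousD; [exact: cf | exact: ch].
move=> [df Df] [dh Dh]; split=> [p Ap|v].
  exact: differentiableD (df _ Ap) (dh _ Ap).
apply: Ck_on_ext oA _ (IH _ _ (Df v) (Dh v)) => p Ap.
by rewrite deriveD//; apply: diff_derivable; [exact: df | exact: dh].
Qed.

Lemma Ck_onM k f h :
  Ck_on k A f -> Ck_on k A h -> Ck_on k A (fun p => f p * h p).
Proof.
elim: k f h => [|k IH] f h.
  by move=> cf ch p Ap; apply: continuousM; [exact: cf | exact: ch].
move=> Cf Ch; have [cf ch] := (Ck_onW _ _ _ _ _ Cf, Ck_onW _ _ _ _ _ Ch).
case: Cf Ch => df Df [dh Dh]; split=> [p Ap|v].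
  exact: differentiableM (df _ Ap) (dh _ Ap).
apply: Ck_on_ext oA _ (Ck_onD k _ _ (IH _ _ cf (Dh v)) (IH _ _ ch (Df v))).
by move=> p Ap; rewrite deriveM//; apply: diff_derivable; [exact: df|exact: dh].
Qed.

Lemma Ck_onV k f :
  (forall p, A p -> f p != 0) -> Ck_on k A f -> Ck_on k A (fun p => (f p)^-1).
Proof.
move=> f0; elim: k f f0 => [|k IH] f f0.
  by move=> cf p Ap; apply: continuousV; [exact: f0 | exact: cf].
move=> Cf; have cf := Ck_onW _ _ _ _ _ Cf; case: Cf => df Df; split=> [p Ap|v].
  exact: differentiableV (df _ Ap) (f0 _ Ap).
have iV := IH _ f0 cf.
have cN : Ck_on k A (fun=> -1 : R) by exact: Ck_on_cst.
apply: Ck_on_ext oA _ (Ck_onM k _ _ cN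
  (Ck_onM k _ _ (Ck_onM k _ _ iV iV) (Df v))) => p Ap.
rewrite deriveV ?f0//; last by apply: diff_derivable; exact: df.
by rewrite mulN1r scaleNr -expr2 exprVn.
Qed.

Lemma smooth_on_cst (c : R) : smooth_on A (fun=> c).
Proof. by move=> k; exact: Ck_on_cst. Qed.

Lemma smooth_onD f h :
  smooth_on A f -> smooth_on A h -> smooth_on A (fun p => f p + h p).
Proof. by move=> sf sh k; exact: Ck_onD. Qed.

Lemma smooth_onM f h :
  smooth_on A f -> smooth_on A h -> smooth_on A (fun p => f p * h p).
Proof. by move=> sf sh k; exact: Ck_onM. Qed.

Lemma smooth_onN f : smooth_on A f -> smooth_on A (fun p => - f p).
Proof.
move=> sf; rewrite (_ : (fun p => - f p) = (fun p => -1 * f p)).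
  by apply: smooth_onM => //; exact: smooth_on_cst.
by apply/funext => p; rewrite mulN1r.
Qed.

Lemma smooth_onV f : (forall p, A p -> f p != 0) ->
  smooth_on A f -> smooth_on A (fun p => (f p)^-1).
Proof. by move=> f0 sf k; exact: Ck_onV. Qed.

Lemma smooth_on_sum m (F : 'I_m -> U -> R) :
  (forall i, smooth_on A (F i)) -> smooth_on A (fun p => \sum_i F i p).
Proof.
elim: m F => [|m IH] F sF.
  rewrite (_ : (fun p => _) = (fun=> 0)); first exact: smooth_on_cst.
  by apply/funext => p; rewrite big_ord0.
rewrite (_ : (fun p => _) =
  (fun p => F ord0 p + \sum_(i < m) F (lift ord0 i) p)).
  by apply: smooth_onD => //; apply: IH.
by apply/funext => p; rewrite big_ord_recl.
Qed.

End Scalar.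

Lemma smooth_on_derive (U V : normedModType R) (A : set U) (f : U -> V) v :
  smooth_on A f -> smooth_on A ('D_v f).
Proof. by move=> sf k; have [_] := sf k.+1; exact. Qed.

Lemma smooth_on_differentiable (U V : normedModType R) (A : set U) (f : U -> V)
  p : smooth_on A f -> A p -> differentiable f p.
Proof. by move=> sf Ap; have [df _] := sf 1; exact: df. Qed.

Lemma smooth_on_sub (U V : normedModType R) (A B : set U) (f : U -> V) :
  A `<=` B -> smooth_on B f -> smooth_on A f.
Proof.
move=> AB sf k; elim: k f sf => [|k IH] f sf.
  by move=> p /AB Bp; exact: (sf 0).
split=> [p /AB Bp|v]; first exact: smooth_on_differentiable sf Bp.
by apply: IH; exact: smooth_on_derive.
Qed.

Lemma differentiable_mx (U : normedModType R) m n (W : U -> 'M[R]_(m, n)) p :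
  (forall i j, differentiable (fun q => W q i j) p) -> differentiable W p.
Proof.
move=> dW; rewrite (_ : W = \sum_(i < m) \sum_(j < n)
    (fun q => W q i j *: delta_mx i j)).
  apply: differentiable_sum => i; apply: differentiable_sum => j.
  exact: differentiableZl.
apply/funext => q; rewrite [LHS]matrix_sum_delta fct_sumE.
by apply: eq_bigr => i _; rewrite fct_sumE.
Qed.

(** A matrix-valued map is differentiated entrywise, so its regularity reduces
to that of its entries; all smoothness proofs below are thus proofs about
scalar functions. *)
Lemma Ck_on_mx (U : normedModType R) m n k (A : set U) (W : U -> 'M[R]_(m, n)) :
  open A -> (forall i j, Ck_on k A (fun p => W p i j)) -> Ck_on k A W.
Proof.
move=> oA; elim: k W => [|k IH] W cW.
  move=> p Ap; apply/cvgrPdist_le => e e0; near=> q.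
  rewrite /Num.Def.normr/= mx_normrE (bigmax_le _ (ltW e0))//= => i _.
  rewrite !mxE/=; move: i; near: q; apply: filter_forall => /= i.
  exact: ((cvgrPdist_le _ _).1 (cW i.1 i.2 p Ap)).
have dW p : A p -> differentiable W p.
  by move=> Ap; apply: differentiable_mx => i j; have [+ _] := cW i j; exact.
split=> // v; apply: IH => i j; have [_ /(_ v)] := cW i j.
apply: Ck_on_ext => // p Ap; rewrite derive_mx ?mxE//.
by apply: diff_derivable; exact: dW.
Unshelve. all: by end_near. Qed.

Lemma smooth_on_mx (U : normedModType R) m n (A : set U) (W : U -> 'M[R]_(m, n)) :
  open A -> (forall i j, smooth_on A (fun p => W p i j)) -> smooth_on A W.
Proof. by move=> oA sW k; apply: Ck_on_mx => // i j; exact: sW. Qed.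

Lemma differentiable_mulmxl (U : normedModType R) m n k (A : 'M[R]_(m, n))
    (W : U -> 'M[R]_(n, k)) p :
  differentiable W p -> differentiable (fun q => A *m W q) p.
Proof.
move=> dW; apply: differentiable_mx => i j.
have -> : (fun q => (A *m W q) i j) =
    \sum_l (cst (A i l) * (fun q => W q l j)).
  by apply/funext => q; rewrite fct_sumE mxE.
apply: differentiable_sum => l; apply: differentiableM.
  exact: differentiable_cst.
apply: (@differentiable_comp _ _ _ _ W (fun N : 'M[R]_(n, k) => N l j)) => //.
exact: differentiable_coord.
Qed.

End SmoothnessCalculus.

(** * Chain rule, mean values and symmetry of second derivatives *)

Section Calculus.
Context {R : realType}.

Lemma is_derive_comp_curve (U V : normedModType R) (c : R -> U) (f : U -> V) t :
  differentiable c t -> differentiable f (c t) ->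
  is_derive t 1 (f \o c) ('D_('D_1 c t) f (c t)).
Proof.
move=> dc df; have dfc := differentiable_comp dc df.
apply: DeriveDef; first exact: diff_derivable.
by rewrite !deriveE// diff_comp.
Qed.

Lemma deriveZr (U V : normedModType R) (f : U -> V) p a v :
  differentiable f p -> 'D_(a *: v) f p = a *: 'D_v f p.
Proof. by move=> df; rewrite !deriveE// linearZ. Qed.

Lemma deriveDr (U V : normedModType R) (f : U -> V) p v w :
  differentiable f p -> 'D_(v + w) f p = 'D_v f p + 'D_w f p.
Proof. by move=> df; rewrite !deriveE// linearD. Qed.

Lemma deriveNr (U V : normedModType R) (f : U -> V) p v :
  differentiable f p -> 'D_(- v) f p = - 'D_v f p.
Proof. by move=> df; rewrite !deriveE// linearN. Qed.

Lemma is_diff_line (U : normedModType R) (p w : U) t :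
  is_diff t (fun s : R => p + s *: w) (fun s => s *: w).
Proof.
have d1 : is_diff t (cst p : R -> U) 0 by exact: is_diff_cst.
have d2 : is_diff t ( *:%R ^~ w : R -> U) ( *:%R ^~ w) by exact: is_diff_scalel.
have := is_diffD d1 d2; rewrite add0r; exact.
Qed.

Lemma is_derive_line (U V : normedModType R) (f : U -> V) p w (t : R) :
  differentiable f (p + t *: w) ->
  is_derive t 1 (fun s : R => f (p + s *: w)) ('D_w f (p + t *: w)).
Proof.
move=> df; have dl := is_diff_line _ p w t.
have [dl1 dl2] := dl.
have := is_derive_comp_curve _ _ (fun s : R => p + s *: w) f t dl1 df.
by rewrite (deriveE _ dl1) dl2 scale1r.
Qed.

Lemma MVT_line (U : normedModType R) (f : U -> R) p w (a : R) :
  (forall q, differentiable f q) ->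
  exists2 t, 0 < t < 1 &
    f (p + a *: w) - f p = a * 'D_w f (p + (t * a) *: w).
Proof.
move=> df.
have [t] : exists2 t, t \in `]0, 1[%R & f (p + 1 *: (a *: w)) - f (p + 0 *: (a *: w)) =
    'D_(a *: w) f (p + t *: (a *: w)) * (1 - 0).
  apply: (@MVT R (fun t => f (p + t *: (a *: w)))) => //.
    by move=> t _; exact: is_derive_line.
  apply: continuous_subspaceT => t; apply: differentiable_continuous.
  apply/derivable1_diffP.
  by have [] := is_derive_line _ _ f p (a *: w) t (df _).
rewrite in_itv/= => /andP[t0 t1]; rewrite scale1r scale0r addr0 subr0 mulr1 => ->.
by exists t; [rewrite t0 | rewrite deriveZr// scalerA].
Qed.

Lemma is_diff_translation (U : normedModType R) (w q : U) :
  is_diff q (fun p => p + w) id.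
Proof.
have d1 : is_diff q (id : U -> U) id by exact: is_diff_id.
have d2 : is_diff q (cst w : U -> U) 0 by exact: is_diff_cst.
by have := is_diffD d1 d2; rewrite addr0; exact.
Qed.

Lemma derive_translation (U V : normedModType R) (f : U -> V) w (q u : U) :
  differentiable f (q + w) ->
  differentiable (fun p => f (p + w)) q /\
  'D_u (fun p => f (p + w)) q = 'D_u f (q + w).
Proof.
move=> df; have [dw dE] := is_diff_translation _ w q.
have dfw := differentiable_comp dw df.
by split=> //; rewrite !deriveE// (diff_comp dw df) dE.
Qed.

(** Apply the mean value theorem in the direction [u] to the increment of [f]
along [a *: v], then in the direction [v] to ['D_u f]. *)
Lemma second_difference (U : normedModType R) (f : U -> R) z u v (a : R) :
  (forall q, differentiable f q) -> (forall q, differentiable ('D_u f) q) ->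
  exists c d, [/\ `|c| <= `|a|, `|d| <= `|a| &
    (f (z + a *: u + a *: v) - f (z + a *: u)) - (f (z + a *: v) - f z) =
    a * (a * 'D_v ('D_u f) (z + c *: u + d *: v))].
Proof.
move=> df ddf.
have dfs q := (derive_translation _ _ f (a *: v) q u (df _)).
have dg q : differentiable (fun p => f (p + a *: v) - f p) q.
  by apply: differentiableB => //; exact: (dfs q).1.
have le_a t : 0 < t < 1 -> `|t * a| <= `|a|.
  by case/andP => t0 t1; rewrite normrM ler_piMl// gtr0_norm// ltW.
have [c ca cE] := MVT_line _ _ z u a dg.
have [d da dE] := MVT_line _ _ (z + (c * a) *: u) v a ddf.
exists (c * a), (d * a); split; [exact: le_a..|rewrite -dE].
rewrite cE; congr (a * _).
have [d1 dE1] := dfs (z + (c * a) *: u).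
have := deriveB (@diff_derivable _ _ _ _ _ u d1)
  (@diff_derivable _ _ _ _ _ u (df (z + (c * a) *: u))).
by rewrite dE1; exact.
Qed.

Lemma le_dist_half (e x y w : R) :
  `|x - w| <= e / 2 -> `|y - w| <= e / 2 -> `|x - y| <= e.
Proof.
move=> xw yw; rewrite (splitr e) (le_trans (ler_distD w _ _))//.
by rewrite lerD// distrC.
Qed.

(** Schwarz: the second difference of [f] over the parallelogram spanned by
[a *: u] and [a *: v] is symmetric in [u] and [v]; divided by [a ^+ 2] it is a
value of either mixed derivative near [z], and both are continuous. *)
Lemma derive_comm (U : normedModType R) (f : U -> R) z u v :
  smooth_on setT f -> 'D_v ('D_u f) z = 'D_u ('D_v f) z.
Proof.
move=> sf; have df q : differentiable f q by exact: smooth_on_differentiable sf _.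
have ddf w q : differentiable ('D_w f) q.
  exact: smooth_on_differentiable (smooth_on_derive _ _ _ _ w sf) _.
have cddf w w' : {for z, continuous ('D_w' ('D_w f))}.
  have s2 := smooth_on_derive _ _ _ _ w' (smooth_on_derive _ _ _ _ w sf).
  exact: (s2 0).
apply/eqP; rewrite -subr_eq0 -normr_le0; apply/ler_addgt0Pl => e e0.
rewrite addr0.
have /cvgrPdist_le/(_ _ (divr_gt0 e0 (ltr0n _ 2))) := cddf u v.
have /cvgrPdist_le/(_ _ (divr_gt0 e0 (ltr0n _ 2))) := cddf v u.
move=> /nbhs_ballP[d1 /= d10 H1] /nbhs_ballP[d2 /= d20 H2].
pose d := Num.min d1 d2; have d0 : 0 < d by rewrite lt_min d10.
pose K := `|u| + `|v| + 1.
have K0 : 0 < K by rewrite ltr_wpDl.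
pose a := d / K / 2.
have a0 : 0 < a by rewrite !divr_gt0.
(* [a] makes the parallelogram at [z] small enough to lie in the ball where
   both mixed derivatives vary by at most [e / 2]. *)
have bnd c c' w w' : `|c| <= `|a| -> `|c'| <= `|a| -> `|w| + `|w'| + 1 = K ->
    `|z - (z + c *: w + c' *: w')| < d.
  move=> ca ca' wK; rewrite -addrA opprD addrA subrr sub0r normrN.
  apply: (@le_lt_trans _ _ (a * (`|w| + `|w'|))).
    rewrite (le_trans (ler_normD _ _))// !normrZ mulrDr -(gtr0_norm a0).
    by rewrite lerD// ler_wpM2r.
  apply: (@lt_trans _ _ (a * K)); first by rewrite ltr_pM2l// -wK ltrDl.
  by rewrite /a mulrAC divfK ?gt_eqF// ltr_pdivrMr// mulr_natr mulr2n ltrDl.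
have [c [c' [ca c'a E1]]] := second_difference _ f z u v a df (ddf _).
have [b [b' [ba b'a E2]]] := second_difference _ f z v u a df (ddf _).
have EE : 'D_v ('D_u f) (z + c *: u + c' *: v) =
          'D_u ('D_v f) (z + b *: v + b' *: u).
  apply: (mulfI (lt0r_neq0 a0)); apply: (mulfI (lt0r_neq0 a0)).
  have swap (x y y' w : R) : x - y - (y' - w) = x - y' - (y - w) by ring.
  apply: etrans (esym E1) (etrans _ E2).
  rewrite [z + a *: u + a *: v]addrAC.
  exact: swap.
have {}H2 : `|'D_v ('D_u f) z - 'D_v ('D_u f) (z + c *: u + c' *: v)| <= e / 2.
  apply: H2; rewrite -ball_normE /=.
  by apply: lt_le_trans (bnd _ _ _ _ ca c'a erefl) _; rewrite ge_min lexx orbT.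
have {}H1 : `|'D_u ('D_v f) z - 'D_u ('D_v f) (z + b *: v + b' *: u)| <= e / 2.
  apply: H1; rewrite -ball_normE /=.
  have wK : `|v| + `|u| + 1 = K by rewrite /K [`|v| + _]addrC.
  by apply: lt_le_trans (bnd _ _ _ _ ba b'a wK) _; rewrite ge_min lexx.
rewrite -EE in H1; move: H2 H1.
exact: le_dist_half.
Qed.

(** The definition of the differential, in the epsilon form used in the
estimates below. *)
Lemma differentiable_bound (U V : normedModType R) (f : U -> V) z (e : R) :
  differentiable f z -> 0 < e ->
  \forall h \near 0, `|f (z + h) - f z - 'D_h f z| <= e * `|h|.
Proof.
move=> df e0; have /diff_locally/eqaddoP/(_ e e0) := df.
apply: filterS => h; rewrite !fctE /= (deriveE _ df) [h + z]addrC.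
by rewrite -[X in `|X|]/(f (z + h) - (f z + 'd f z h)) opprD addrA.
Qed.

End Calculus.

(** * Functions vanishing on a hypersurface *)

Section TangentialDerivative.
Context {R : realType}.

Lemma IVT_sign (F : R -> R) a b : a <= b -> continuous F -> F a < 0 -> 0 < F b ->
  exists2 c, a <= c <= b & F c = 0.
Proof.
move=> ab cF Fa Fb; have [||c] := @IVT R F a b 0 ab.
- exact: continuous_subspaceT.
- by rewrite ge_min le_max (ltW Fa) (ltW Fb) orbT.
- by rewrite in_itv/= => cab Fc; exists c.
Qed.

Lemma continuous_line (U : normedModType R) (f : U -> R) p w :
  continuous f -> continuous (fun s : R => f (p + s *: w)).
Proof.
move=> cf s; apply: (@continuous_comp _ _ _ (fun s : R => p + s *: w) f).
  by have [d _] := is_diff_line _ p w s; exact: differentiable_continuous.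
exact: cf.
Qed.

Lemma le_scaled_eq0 (x m : R) :
  0 <= m -> (forall e, 0 < e <= 1 -> `|x| <= e * (m + 1)) -> x = 0.
Proof.
move=> m0 H; apply/eqP; apply: contraT; rewrite -normr_gt0 => x0.
have m1 : 0 < m + 1 by rewrite ltr_wpDl.
pose e := Num.min 1 (`|x| / (m + 1) / 2).
have e0 : 0 < e <= 1 by rewrite lt_min ltr01 !divr_gt0//= ge_min lexx.
exfalso; have := H e e0; apply/negP; rewrite -ltNge.
apply: (@le_lt_trans _ _ (`|x| / (m + 1) / 2 * (m + 1))).
  by apply: ler_wpM2r; [exact: ltW | rewrite ge_min lexx orbT].
by rewrite mulrAC divfK ?gt_eqF// ltr_pdivrMr// mulr_natr mulr2n ltrDl.
Qed.

Lemma near0_translate (U : normedModType R) (P : set U) z :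
  (\near z, P z) -> \forall h \near 0, P (z + h).
Proof.
rewrite (near_shift 0 z); apply: filterS => h /=.
by rewrite subr0 addrC.
Qed.

(** A function that vanishes on the zero set of [f] has zero derivative in
every direction tangent to it. Points of the zero set suffice for this: for
small [t], the intermediate value theorem gives a zero of [f] of the form
[z + t *: v + (t * s) *: nu] with [s] as small as desired, because [f] grows at
unit rate along [nu] and not at all, to first order, along [v]. The first order
expansion of [phi] at this zero bounds ['D_v phi z]. *)
Lemma tangential_derive_eq0 (U : normedModType R) (f phi : U -> R) z nu v :
  continuous f -> differentiable f z -> differentiable phi z ->
  f z = 0 -> (\near z, f z = 0 -> phi z = 0) ->
  'D_nu f z = 1 -> 'D_v f z = 0 -> 'D_v phi z = 0.
Proof.
move=> cf df dphi fz fphi fnu fv.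
apply: (@le_scaled_eq0 _ `|'D_nu phi z|) => // e /andP[e0 e1].
pose K := `|v| + `|nu| + 1; have K0 : 0 < K by rewrite ltr_wpDl.
(* With this [e'], the first order error at distance [t * K] is at most
   [t * (e / 2)], half of the value [t * e] of the differential of [f] at
   [(t * e) *: nu]. *)
pose e' := e / K / 2; have e'0 : 0 < e' by rewrite !divr_gt0.
have : \forall h \near 0, [/\ `|f (z + h) - f z - 'D_h f z| <= e' * `|h|,
    `|phi (z + h) - phi z - 'D_h phi z| <= e' * `|h| &
    f (z + h) = 0 -> phi (z + h) = 0].
  have := differentiable_bound _ _ f z e' df e'0.
  have := differentiable_bound _ _ phi z e' dphi e'0.
  by have := near0_translate _ _ z fphi; apply: filterS3 => h; split.
move=> /nbhs_normP[d /= d0 Hd].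
pose t := d / K / 2; have t0 : 0 < t by rewrite !divr_gt0.
have tK : t * K = d / 2 by rewrite /t mulrAC divfK ?gt_eqF.
have eK : e' * K = e / 2 by rewrite /e' mulrAC divfK ?gt_eqF.
pose w s : U := t *: v + (t * s) *: nu.
have wle s : `|s| <= e -> `|w s| <= t * K.
  move=> se; have -> : w s = t *: (v + s *: nu) by rewrite scalerDr scalerA.
  rewrite normrZ gtr0_norm// ler_pM2l//.
  apply: le_trans (ler_normD _ _) _; rewrite /K -addrA lerD2l normrZ.
  have : `|s| * `|nu| <= 1 * `|nu| by rewrite ler_wpM2r// (le_trans se).
  lra.
have Hw s : `|s| <= e -> [/\ `|f (z + w s) - t * s| <= t * (e / 2),
    `|phi (z + w s) - phi z - t * ('D_v phi z + s * 'D_nu phi z)| <= t * (e / 2) &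
    f (z + w s) = 0 -> phi (z + w s) = 0].
  move=> se; have wd : `|w s| < d.
    by rewrite (le_lt_trans (wle _ se))// tK ltr_pdivrMr// mulr_natr mulr2n ltrDl.
  have [|fw phiw fphiw] := Hd (w s); first by rewrite /= sub0r normrN.
  have e'w : e' * `|w s| <= t * (e / 2).
    by rewrite -eK mulrCA ler_pM2l// wle.
  split=> //.
    move: (le_trans fw e'w).
    by rewrite deriveDr// !deriveZr// fz fnu fv scaler0 add0r subr0 [_ *: 1]mulr1.
  move: (le_trans phiw e'w).
  by rewrite deriveDr// !deriveZr// mulrDr mulrA.
have phiz : phi z = 0 by exact: (nbhs_singleton fphi).
have zw s : z + t *: v + (t * s) *: nu = z + w s by rewrite addrA.
have ee : `|e| <= e by rewrite gtr0_norm.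
have eNe : `|- e| <= e by rewrite normrN.
have te0 : 0 < t * (e / 2) by rewrite mulr_gt0// divr_gt0.
have [||||s /andP[s1 s2] fs] :=
    @IVT_sign (fun s => f ((z + t *: v) + s *: nu)) (t * - e) (t * e).
- by rewrite ler_pM2l// (@le_trans _ _ 0)// ?oppr_le0 ltW.
- exact: continuous_line.
- rewrite zw; have [+ _ _] := Hw _ eNe; rewrite ler_norml => /andP[_ H].
  have -> : f (z + w (- e)) = (f (z + w (- e)) - t * - e) - t * (e / 2) * 2 by field.
  lra.
- rewrite zw; have [+ _ _] := Hw _ ee; rewrite ler_norml => /andP[H _].
  lra.
have se : `|s / t| <= e.
  by rewrite ler_norml ler_pdivlMr// ler_pdivrMr// ![_ * t]mulrC s1 s2.
have [_ Hphi f0] := Hw _ se.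
move: fs; rewrite -[s in LHS](divfK (lt0r_neq0 t0)) [_ / t * t]mulrC zw => /f0 phi0.
move: Hphi; rewrite phi0 phiz subr0 sub0r normrN normrM gtr0_norm// ler_pM2l// => H.
have -> : 'D_v phi z = ('D_v phi z + s / t * 'D_nu phi z) - s / t * 'D_nu phi z.
  by rewrite addrK.
rewrite (le_trans (ler_normB _ _))// normrM.
have : `|s / t| * `|'D_nu phi z| <= e * `|'D_nu phi z| by rewrite ler_wpM2r.
lra.
Qed.
End TangentialDerivative.

(** * Implicit functions *)

Section LevelCurve.
Context {R : realType} {U : normedModType R}.
Variables (f : U -> R) (z v nu : U).
Hypotheses (df : forall p, differentiable f p)
  (cDf : forall p, {for p, continuous ('D_nu f)})
  (fz : f z = 0) (fnu : 0 < 'D_nu f z).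

Let P (t s : R) : U := z + t *: v + s *: nu.

Let continuous_f : continuous f.
Proof. by move=> p; exact: differentiable_continuous. Qed.

Let P00 : P 0 0 = z.
Proof. by rewrite /P !scale0r !addr0. Qed.

Let PDs t s c : P t (s + c) = P t s + c *: nu.
Proof. by rewrite /P scalerDl addrA. Qed.

Let PD t s h k : P (t + h) (s + k) = P t s + (h *: v + k *: nu).
Proof. by rewrite /P !scalerDl !addrA; congr (_ + _); rewrite addrAC. Qed.

Let box : exists2 r : R, 0 < r &
  forall t s, `|t| <= r -> `|s| <= r -> 0 < 'D_nu f (P t s).
Proof.
have /nbhs_normP[d /= d0 Hd] : \forall p \near z, 0 < 'D_nu f p.
  exact: cvgr_gt (cDf z) _ fnu.
pose K := `|v| + `|nu| + 1; have K0 : 0 < K by rewrite ltr_wpDl.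
have r0 : 0 < d / K / 2 by rewrite !divr_gt0.
exists (d / K / 2) => // t s tr sr; apply: Hd => /=.
rewrite /P -addrA opprD addrA subrr sub0r normrN.
apply: le_lt_trans (ler_normD _ _) _; rewrite !normrZ.
have tv : `|t| * `|v| <= d / K / 2 * `|v| by rewrite ler_wpM2r.
have sv : `|s| * `|nu| <= d / K / 2 * `|nu| by rewrite ler_wpM2r.
have dE : d = d / K / 2 * K * 2 by field; rewrite gt_eqF.
rewrite /K in dE; lra.
Qed.

Let increasing r t s1 s2 :
  (forall t s, `|t| <= r -> `|s| <= r -> 0 < 'D_nu f (P t s)) ->
  `|t| <= r -> `|s1| <= r -> `|s2| <= r -> s1 < s2 -> f (P t s1) < f (P t s2).
Proof.
move=> Dpos tr s1r s2r s12.
have [x /andP[x0 x1]] := MVT_line _ f (P t s1) nu (s2 - s1) df.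
rewrite -!PDs subrKC => E; rewrite -subr_gt0 E mulr_gt0 ?subr_gt0//.
apply: Dpos => //; move: s1r s2r; rewrite !ler_norml => /andP[? ?] /andP[? ?].
have y0 : 0 <= x * (s2 - s1) by rewrite mulr_ge0 ?subr_ge0 ?ltW.
have y1 : x * (s2 - s1) <= 1 * (s2 - s1) by rewrite ler_wpM2r ?subr_ge0 ?ltW.
by apply/andP; split; lra.
Qed.

Let continuous_t s : continuous (fun t => f (P t s)).
Proof.
rewrite (_ : (fun t => _) = (fun t => f ((z + s *: nu) + t *: v))).
  exact: continuous_line.
by apply/funext => t; rewrite /P addrAC.
Qed.

Let near_sign t s : let F := fun t => f (P t s) in
  (F t < 0 -> \forall x \near t, F x < 0) /\
  (0 < F t -> \forall x \near t, 0 < F x).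
Proof.
split=> Ft; [exact: cvgr_lt (continuous_t s t) _ Ft|].
exact: cvgr_gt (continuous_t s t) _ Ft.
Qed.

Let solution : exists r e, [/\ 0 < e <= r,
  forall t s, `|t| <= r -> `|s| <= r -> 0 < 'D_nu f (P t s) &
  exists s : R -> R, forall t, `|t| < e -> `|s t| < r /\ f (P t (s t)) = 0].
Proof.
have [r r0 Dpos] := box.
have r1 : `|r| <= r by rewrite gtr0_norm.
have r2 : `|- r| <= r by rewrite normrN.
have r3 : `|0 : R| <= r by rewrite normr0 ltW.
have f00 : f (P 0 0) = 0 by rewrite P00.
have fl : f (P 0 (- r)) < 0.
  by rewrite -[X in _ < X]f00; apply: (increasing r); rewrite ?oppr_lt0.
have fr : 0 < f (P 0 r).
  by rewrite -[X in X < _]f00; exact: (increasing r).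
have : \forall t \near 0, f (P t (- r)) < 0 /\ 0 < f (P t r).
  have := (near_sign 0 (- r)).1 fl; have := (near_sign 0 r).2 fr.
  by apply: filterS2 => t.
move=> /nbhs_normP[d /= d0 Hd].
exists r, (Num.min d r); split=> //; first by rewrite lt_min d0 r0 ge_min lexx orbT.
suff /choice[s Hs] : forall t, exists s, `|t| < Num.min d r ->
  `|s| < r /\ f (P t s) = 0 by exists s.
move=> t; have [tlt|_] := boolP (`|t| < Num.min d r); last by exists 0.
have [|fl' fr'] := Hd t.
  by rewrite /= sub0r normrN (lt_le_trans tlt)// ge_min lexx.
have [||||s /andP[s1 s2] fs] := @IVT_sign R (fun s => f (P t s)) (- r) r.
- by rewrite (@le_trans _ _ 0)// ?oppr_le0 ltW.
- exact: continuous_line.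
- by [].
- by [].
exists s => _; split=> //; rewrite ltr_norml !lt_neqAle s1 s2 !andbT.
apply/andP; split; apply/eqP => E.
  by move: fl'; rewrite E fs ltxx.
by move: fr'; rewrite -E fs ltxx.
Qed.

(** On a box where ['D_nu f] is positive, [f] increases along [nu], so that the
zero [s t] of [f] on the line through [z + t *: v] is unique. Uniqueness gives
continuity of [s], by trapping [s t] between points where [f] has opposite
signs; the first order expansion of [f] at the zero then gives the
derivative. *)
Lemma implicit_function : exists e (s : R -> R), [/\ 0 < e, s 0 = 0 &
  forall t, `|t| < e -> let p := z + t *: v + s t *: nu in
    [/\ f p = 0, 0 < 'D_nu f p & is_derive t 1 s (- ('D_v f p / 'D_nu f p))]].
Proof.
have [r [e [/andP[e0 er] Dpos [s Hs]]]] := solution.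
have inr (t : R) : `|t| < e -> `|t| <= r by move=> te; rewrite ltW// (lt_le_trans te).
exists e, s; split=> //.
  have [|s0r fs0] := Hs 0; first by rewrite normr0.
  have f00 : f (P 0 0) = 0 by rewrite P00.
  have r0 : `|0 : R| <= r by rewrite normr0 ltW// (lt_le_trans e0).
  have [lt0|lt0|//] := ltgtP (s 0) 0.
    by have := increasing r 0 _ _ Dpos r0 (ltW s0r) r0 lt0; rewrite fs0 f00 ltxx.
  by have := increasing r 0 _ _ Dpos r0 r0 (ltW s0r) lt0; rewrite fs0 f00 ltxx.
move=> t te p; have [str fp] := Hs t te.
have q0 : 0 < 'D_nu f p by apply: Dpos; [exact: inr | exact: ltW].
split=> //.
have near_te : \forall h \near 0, `|t + h| < e.
  apply: (near0_translate _ (fun t => `|t| < e)).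
  exact: cvgr_lt (@norm_continuous _ _ t) _ te.
have small (d : R) : 0 < d -> \forall h \near 0, `|s (t + h) - s t| <= d.
  move=> d0; pose d' := Num.min d (r - `|s t|).
  have d'0 : 0 < d' by rewrite lt_min d0 subr_gt0.
  have d'r : d' <= r - `|s t| by rewrite ge_min lexx orbT.
  have /andP[sr1 sr2] : - `|s t| <= s t <= `|s t| by rewrite -ler_norml.
  have ltr' : `|s t - d'| <= r by rewrite ler_norml; apply/andP; split; lra.
  have gtr' : `|s t + d'| <= r by rewrite ler_norml; apply/andP; split; lra.
  have sl : s t - d' < s t by rewrite ltrBlDr ltrDl.
  have sg : s t < s t + d' by rewrite ltrDl.
  have fl := increasing r t _ _ Dpos (inr _ te) ltr' (ltW str) sl.
  have fg := increasing r t _ _ Dpos (inr _ te) (ltW str) gtr' sg.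
  rewrite fp in fl fg.
  have := near0_translate _ _ _ ((near_sign t (s t - d')).1 fl).
  have := near0_translate _ _ _ ((near_sign t (s t + d')).2 fg).
  move: near_te; apply: filterS3 => h teh fhg fhl.
  have [sthr fth] := Hs _ teh.
  apply: (@le_trans _ _ d'); last by rewrite ge_min lexx.
  rewrite ler_norml lerBrDr lerBlDr [- d' + _]addrC [d' + _]addrC.
  rewrite leNgt [X in _ && X]leNgt; apply/andP; split; apply/negP => sth.
    have := increasing r (t + h) _ _ Dpos (inr _ teh) (ltW sthr) ltr' sth.
    by rewrite fth => /lt_trans /(_ fhl); rewrite ltxx.
  have := increasing r (t + h) _ _ Dpos (inr _ teh) gtr' (ltW sthr) sth.
  by rewrite fth => /(lt_trans fhg); rewrite ltxx.
pose a := 'D_v f p; pose q := 'D_nu f p; rewrite -/a -/q in q0 *.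
(* Both points lie on the zero set of [f], hence the increment
   [h *: v + k *: nu] between them satisfies [q * k + a * h = o(|h| + |k|)].
   As [q] is not zero, this makes [k] of order [h], and the error is o(h). *)
have slope (d : R) : 0 < d ->
    \forall h \near 0, `|q * (s (t + h) - s t) + a * h| <= d * `|h|.
  move=> d0; pose N := `|v| + `|nu| + 1; have N0 : 0 < N by rewrite ltr_wpDl.
  have aq0 : 0 < 2 * q + 2 * `|a| by rewrite ltr_wpDr ?mulr_ge0 ?mulr_gt0.
  (* The first bound on [e2] absorbs the error in [|k|] into [q * |k|], giving
     [q * |k| <= (q + 2 * |a|) * |h|]; the second turns this into [d * |h|]. *)
  pose e2 := Num.min (q / 2) (d * q / (2 * q + 2 * `|a|)).
  have e20 : 0 < e2 by rewrite lt_min !divr_gt0// mulr_gt0.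
  have e2q : e2 <= q / 2 by rewrite ge_min lexx.
  have e2d : e2 * (2 * q + 2 * `|a|) <= d * q.
    by rewrite -ler_pdivlMr// ge_min lexx orbT.
  have e1N : e2 / N * N = e2 by rewrite divfK ?gt_eqF.
  have e10 : 0 < e2 / N by rewrite divr_gt0.
  have /nbhs_normP[b /= b0 Hb] := differentiable_bound _ _ f p _ (df p) e10.
  have [c [bN0 bE]] : exists c, 0 < c /\ b = c * N * 2.
    exists (b / N / 2); split; first by rewrite !divr_gt0.
    by field; rewrite gt_eqF.
  have h_small : \forall h \near (0 : R), `|h| < c.
    by apply/nbhs_normP; exists (c) => // h /=; rewrite sub0r normrN.
  move: near_te (small _ bN0) h_small; apply: filterS3 => h teh kb hb.
  pose k := s (t + h) - s t; rewrite -/k in kb *.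
  pose w := h *: v + k *: nu.
  have wn : `|w| <= `|h| * `|v| + `|k| * `|nu|.
    by rewrite -!normrZ; exact: ler_normD.
  have wb : `|w| < b.
    apply: le_lt_trans wn _.
    have hv : `|h| * `|v| <= c * `|v| by rewrite ler_wpM2r// ltW.
    have kv : `|k| * `|nu| <= c * `|nu| by rewrite ler_wpM2r.
    have := mulr_ge0 (ltW bN0) (normr_ge0 v).
    have := mulr_ge0 (ltW bN0) (normr_ge0 nu).
    rewrite bE /N; lra.
  have pw : f (p + w) = 0.
    by have [_] := Hs _ teh; rewrite -[s (t + h)](subrKC (s t)) PD.
  have := Hb w; rewrite /= sub0r normrN => /(_ wb).
  rewrite pw fp subrr sub0r normrN deriveDr// !deriveZr// -/a -/q => Hw.
  have {}Hw : `|q * k + a * h| <= e2 * (`|h| + `|k|).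
    have -> : q * k + a * h = h * a + k * q by ring.
    apply: le_trans Hw _; rewrite -{2}e1N -mulrA ler_pM2l//.
    apply: le_trans wn _; rewrite /N.
    have [h0 k0 v0 n0] := And4 (normr_ge0 h) (normr_ge0 k) (normr_ge0 v) (normr_ge0 nu).
    have := mulr_ge0 h0 n0; have := mulr_ge0 k0 v0; lra.
  have kq : q * `|k| <= `|q * k + a * h| + `|a| * `|h|.
    rewrite -{1}(gtr0_norm q0) -!normrM -{1}(addrK (a * h) (q * k)).
    exact: ler_normB.
  apply: (le_trans Hw); rewrite -(ler_pM2l q0).
  have kM : q * `|k| <= (q + 2 * `|a|) * `|h|.
    have e2h : e2 * `|h| <= q / 2 * `|h| by exact: ler_wpM2r.
    have e2k : e2 * `|k| <= q / 2 * `|k| by exact: ler_wpM2r.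
    have {}kq := le_trans kq (lerD Hw (lexx _)).
    lra.
  have e2M : e2 * (q * `|k|) <= e2 * ((q + 2 * `|a|) * `|h|).
    by apply: ler_wpM2l => //; exact: ltW.
  have e2h : e2 * (2 * q + 2 * `|a|) * `|h| <= d * q * `|h| by exact: ler_wpM2r.
  lra.
have cvg_slope : h^-1 *: (s (h *: 1 + t) - s t) @[h --> 0^'] --> - (a / q).
  apply/cvgrPdist_le => d d0.
  have : \forall h \near (0 : R)^', `|q * (s (t + h) - s t) + a * h| <= d * q * `|h|.
    by apply: cvg_within; apply: slope; rewrite mulr_gt0.
  apply: filter_app; near=> h; have h0 : h != 0 by near: h; exact: nbhs_dnbhs_neq.
  move=> H.
  have -> : - (a / q) - h^-1 *: (s (h *: 1 + t) - s t) =
      - ((q * (s (t + h) - s t) + a * h) / (q * h)).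
    have gen (k : R) : - (a / q) - h^-1 * k = - ((q * k + a * h) / (q * h)).
      by field; rewrite h0 gt_eqF.
    rewrite [h *: 1]mulr1 [h + t]addrC; exact: gen.
  have qh0 : 0 < `|q * h| by rewrite normr_gt0 mulf_neq0// gt_eqF.
  rewrite normrN normf_div ler_pdivrMr//.
  by rewrite normrM (gtr0_norm q0) mulrA.
apply: DeriveDef; first by apply/cvg_ex; exists (- (a / q)).
exact/cvg_lim.
Unshelve. all: by end_near. Qed.

End LevelCurve.

(** * Smooth curves in a level set *)

Section SmoothLevelCurve.
Context {R : realType}.

(** The curve is an integral curve of the smooth field
[X p = v + w p *: nu], so the derivative of [h \o c] is [(X h) \o c], where
[X h] is again smooth. The statement quantifies over all [h] so that
the induction on the order of regularity applies to [X h]. *)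
Lemma smooth_on_comp_curve (U : normedModType R) (A : set U) (I : set R)
    (c : R -> U) (v nu : U) (w : U -> R) :
  open A -> open I ->
  (forall t, I t -> A (c t)) ->
  (forall t, I t -> differentiable c t) ->
  (forall t, I t -> 'D_1 c t = v + w (c t) *: nu) ->
  smooth_on A w ->
  forall h : U -> R, smooth_on A h -> smooth_on I (h \o c).
Proof.
move=> oA oI IA dc Dc sw h sh k; elim: k h sh => [|k IH] h sh.
  move=> t It; apply: continuous_comp.
    exact: differentiable_continuous (dc t It).
  exact: (sh 0 _ (IA t It)).
have dh t : I t -> differentiable h (c t).
  by move=> It; exact: smooth_on_differentiable sh (IA t It).
split=> [t It|u]; first by apply: differentiable_comp; [exact: dc | exact: dh].
have sh' : smooth_on A (fun p => u * ('D_v h p + w p * 'D_nu h p)).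
  apply: smooth_onM => //; first exact: smooth_on_cst.
  apply: smooth_onD => //; first exact: smooth_on_derive.
  by apply: smooth_onM => //; exact: smooth_on_derive.
apply: Ck_on_ext oI _ (IH _ sh') => t It /=.
have [dhc hcE] := is_derive_comp_curve _ _ c h t (dc t It) (dh t It).
have -> : u = u *: 1 by rewrite [RHS]mulr1.
rewrite (deriveZr _ _ (h \o c)); last exact/derivable1_diffP.
rewrite hcE Dc// (deriveDr _ _ _ _ _ _ (dh t It)) (deriveZr _ _ _ _ _ _ (dh t It)).
by rewrite [u *: 1]mulr1.
Qed.

Lemma smooth_on_coord m k (A : set 'M[R]_(m, k)) i j :
  open A -> smooth_on A (fun p : 'M[R]_(m, k) => p i j).
Proof.
move=> oA; suff H q : Ck_on q.+1 A (fun p : 'M[R]_(m, k) => p i j).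
  by move=> q; apply: Ck_onW; exact: H.
split=> [p _|v]; first exact: differentiable_coord.
apply: Ck_on_ext oA _ (Ck_on_cst _ _ q A (v i j)) => p _ /=.
apply/esym; have := @derive_mx R _ m k (id : 'M[R]_(m, k) -> _) p v.
by rewrite derive_id => /(_ (@derivable_id _ _ _ _))/matrixP/(_ i j); rewrite mxE.
Qed.

(** The curve [z + t *: v + s t *: nu], where [s] is the implicit function. It
is an integral curve of a smooth field by the formula for the derivative of
[s], and its entries are the coordinate functions composed with it. *)
Lemma level_curve m k (f : 'M[R]_(m, k) -> R) (z v nu : 'M[R]_(m, k)) :
  smooth_on setT f -> f z = 0 -> 0 < 'D_nu f z ->
  exists (e : R) (c : R -> 'M[R]_(m, k)), [/\ 0 < e,
    smooth_on `]- e, e[%classic c,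
    forall t, t \in `]- e, e[ -> f (c t) = 0,
    c 0 = z & 'D_1 c 0 = v - ('D_v f z / 'D_nu f z) *: nu].
Proof.
move=> sf fz fnu.
have df p : differentiable f p by exact: smooth_on_differentiable sf _.
have sD w := smooth_on_derive _ _ _ _ w sf.
have cDf p : {for p, continuous ('D_nu f)} by exact: (sD nu 0).
have [e [s [e0 s0 Hs]]] := implicit_function f z v nu df cDf fz fnu.
pose c t := z + t *: v + s t *: nu; exists e, c.
pose I := `]- e, e[%classic; pose A := [set p | 0 < 'D_nu f p].
have IE (t : R) : I t -> `|t| < e by rewrite /I /= in_itv/= ltr_norml.
have oI : open I by exact: interval_open.
have oA : open A.
  have -> : A = 'D_nu f @^-1` [set x | 0 < x] by [].
  by apply: open_comp; [move=> p _; exact: cDf | exact: open_gt].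
pose w p := - ('D_v f p / 'D_nu f p).
have dc (t : R) : I t -> differentiable c t /\ 'D_1 c t = v + w (c t) *: nu.
  move=> /IE/Hs[_ _ [/derivable1_diffP ds sE]].
  have [d1 d1E] := is_diff_line _ z v t.
  have d2 := differentiableZl nu ds.
  have dct : differentiable c t by exact: differentiableD d1 d2.
  split=> //.
  have D1 : 'D_1 (fun t : R => z + t *: v) t = v.
    by rewrite (deriveE _ d1) d1E scale1r.
  have D2 : 'D_1 (fun t : R => s t *: nu) t = w (c t) *: nu.
    by rewrite (deriveE _ d2) diffZl// -(deriveE _ ds) sE.
  have e1 : derivable (fun t : R => z + t *: v) t 1 by exact: diff_derivable.
  have e2 : derivable (fun t : R => s t *: nu) t 1 by exact: diff_derivable.
  have := deriveD e1 e2.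
  by rewrite D1 D2; exact.
have sw : smooth_on A w.
  apply: smooth_onN => //; apply: smooth_onM => //.
    by apply: smooth_on_sub (sD v).
  apply: smooth_onV => //; first by move=> p Ap; rewrite gt_eqF.
  by apply: smooth_on_sub (sD nu).
have I0 : I 0 by rewrite /I /= in_itv/= oppr_lt0 e0.
have c0 : c 0 = z by rewrite /c s0 !scale0r !addr0.
split=> //.
- apply: smooth_on_mx => // i j.
  apply: (smooth_on_comp_curve _ A I c v nu w oA oI _ _ _ sw
    (fun p : 'M[R]_(m, k) => p i j)).
  + by move=> t /IE/Hs[].
  + by move=> t /dc[].
  + by move=> t /dc[].
  + exact: smooth_on_coord.
- by move=> t tI; have [] := Hs t (IE t tI).
- by rewrite (dc 0 I0).2 c0 /w scaleNr.
Qed.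

End SmoothLevelCurve.

(** * Orthonormal bases, Euclidean and complex structures *)

Section OrthonormalBases.
Context {K : fieldType} {m : nat} (sigma : {rmorphism K -> K}).
Hypothesis sigmaK : involutive sigma.

Let ip (v w : 'cV[K]_m) : K := \sum_i v i 0 * sigma (w i 0).

Let ipC v w : ip v w = sigma (ip w v).
Proof.
rewrite /ip rmorph_sum; apply: eq_bigr => i _.
by rewrite rmorphM sigmaK mulrC.
Qed.

Let ipD u v w : ip (u + v) w = ip u w + ip v w.
Proof.
by rewrite /ip -big_split; apply: eq_bigr => i _; rewrite mxE mulrDl.
Qed.

Let ipZ a v w : ip (a *: v) w = a * ip v w.
Proof. by rewrite /ip mulr_sumr; apply: eq_bigr => i _; rewrite mxE mulrA. Qed.

Let ip_sum k (c : 'I_k -> K) (e : 'I_k -> 'cV[K]_m) w :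
  ip (\sum_i c i *: e i) w = \sum_i c i * ip (e i) w.
Proof.
elim/big_ind2 : _ => [||i _]; last exact: ipZ.
  by rewrite /ip big1// => i _; rewrite mxE mul0r.
by move=> x ? y ? <- <-; exact: ipD.
Qed.

Let orthonormal k (e : 'I_k -> 'cV[K]_m) :=
  forall i j, ip (e i) (e j) = (i == j)%:R.

(* The matrix of an orthonormal family has a one-sided inverse. *)
Let orthonormal_size k (e : 'I_k -> 'cV[K]_m) : orthonormal k e -> (k <= m)%N.
Proof.
move=> oe; pose A := \matrix_(i < k, j < m) e i j 0.
pose B := \matrix_(j < m, i < k) sigma (e i j 0).
apply: (@mulmx1_min _ _ _ A B); apply/matrixP => i j; rewrite !mxE -oe.
by apply: eq_bigr => l _; rewrite !mxE.
Qed.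

(** [sigma] is the identity for the Euclidean product and the conjugation for
the hermitian one. The sizes of orthonormal families are bounded by [m]; one of
maximal size spans [S], since otherwise the residual of the projection of a
vector of [S] could be normalized and added to it. *)
Lemma orthonormal_basis_exists (S : set 'cV[K]_m) :
  S 0 -> (forall a v w, S v -> S w -> S (a *: v + w)) ->
  (forall w, S w -> w != 0 -> exists a, ip (a *: w) (a *: w) = 1) ->
  exists k (e : 'I_k -> 'cV[K]_m), orthonormal_basis ip S e.
Proof.
move=> S0 Slin Snorm.
pose Q k := `[< exists e : 'I_k -> 'cV[K]_m,
  (forall i, S (e i)) /\ orthonormal k e >].
have Q0 : exists k, Q k.
  by exists 0; apply/asboolP; exists (fun=> 0); split=> [//|[]].
have Qm k : Q k -> (k <= m)%N by move=> /asboolP[e [_]]; exact: orthonormal_size.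
have [k /asboolP[e [Se oe]] kmax] := ex_maxnP Q0 Qm.
exists k, e; split=> // v Sv; exists (fun i => ip v (e i)).
apply/eqP; rewrite -subr_eq0; apply: contraT => w0.
set w := v - _ in w0.
have Ssum : S (\sum_i ip v (e i) *: e i).
  elim/big_rec : _ => // i x _ Sx; exact: Slin.
have Sw : S w by rewrite /w addrC -scaleN1r; exact: Slin.
have wE j : ip w (e j) = 0.
  rewrite /w ipD -scaleN1r ipZ ip_sum (bigD1 j)//= oe eqxx mulr1 big1 ?addr0.
    by rewrite mulN1r subrr.
  by move=> i ij; rewrite oe (negbTE ij) mulr0.
have [a aw] := Snorm w Sw w0.
pose e' (i : 'I_k.+1) := if unlift ord_max i is Some j then e j else a *: w.
suff /kmax : Q k.+1 by rewrite ltnn.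
apply/asboolP; exists e'; split=> [i|i j]; rewrite /e'.
  by case: unliftP => // _; rewrite -[_ *: _]addr0; exact: Slin.
case: unliftP => [i'|] ->; case: unliftP => [j'|] ->.
- by rewrite oe (inj_eq lift_inj).
- by rewrite ipC ipZ wE mulr0 rmorph0 eq_sym (negbTE (neq_lift _ _)).
- by rewrite ipZ wE mulr0 (negbTE (neq_lift _ _)).
- by rewrite eqxx.
Qed.

End OrthonormalBases.

(** [trace_wrt] picks one basis; it is determined once all bases agree. *)
Lemma trace_wrtE (K : fieldType) (V : lmodType K) (ip : V -> V -> K) (S : set V)
    (b : V -> V -> K) t :
  (exists k (e : 'I_k -> V), orthonormal_basis ip S e) ->
  (forall k (e : 'I_k -> V), orthonormal_basis ip S e ->
    \sum_i b (e i) (e i) = t) ->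
  trace_wrt ip S b = t.
Proof.
move=> [k [e oe]] bt; apply: xget_unique.
  by exists k, e; split=> //; rewrite bt.
by move=> _ [l [d [od ->]]]; exact: bt.
Qed.

Section Frames.
Context {K : fieldType} {m : nat}.

Lemma eq_mulmx_cV (A B : 'M[K]_m) : (forall v : 'cV_m, A *m v = B *m v) -> A = B.
Proof.
move=> AB; apply/matrixP => i j.
have /matrixP/(_ i 0) := AB (delta_mx j 0).
by rewrite -!colE !mxE.
Qed.

End Frames.

Section Euclidean.
Context {K : comPzRingType} {n : nat}.
Implicit Types u v w : vec K n.

Lemma gE v w : g v w = (v^T *m w) 0 0.
Proof. by rewrite mxE; apply: eq_bigr => i _; rewrite mxE. Qed.

Lemma gC v w : g v w = g w v.
Proof. by apply: eq_bigr => i _; rewrite mulrC. Qed.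

Lemma gDl u v w : g (u + v) w = g u w + g v w.
Proof. by rewrite /g -big_split; apply: eq_bigr => i _; rewrite mxE mulrDl. Qed.

Lemma gZl a v w : g (a *: v) w = a * g v w.
Proof. by rewrite /g mulr_sumr; apply: eq_bigr => i _; rewrite mxE mulrA. Qed.

Lemma gNl v w : g (- v) w = - g v w.
Proof. by rewrite -scaleN1r gZl mulN1r. Qed.

Lemma gDr u v w : g u (v + w) = g u v + g u w.
Proof. by rewrite gC gDl !(gC u). Qed.

Lemma gZr a v w : g v (a *: w) = a * g v w.
Proof. by rewrite gC gZl gC. Qed.

Lemma gNr v w : g v (- w) = - g v w.
Proof. by rewrite gC gNl gC. Qed.

Lemma g0r v : g v 0 = 0.
Proof. by rewrite -(scale0r 0) gZr mul0r. Qed.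

Lemma g_suml (I : Type) (r : seq I) (F : I -> vec K n) w :
  g (\sum_(i <- r) F i) w = \sum_(i <- r) g (F i) w.
Proof.
elim/big_ind2 : _ => [|x ? y ? <- <-|//]; last exact: gDl.
by rewrite -(scale0r 0) gZl mul0r.
Qed.

Lemma mul_outer u v w : u *m w^T *m v = g v w *: u.
Proof.
by rewrite -mulmxA [w^T *m v]mx11_scalar -gE gC mul_mx_scalar.
Qed.

Lemma mxtrace_outer (M : 'M[K]_(n.+1 + n.+1)) u : \tr (M *m (u *m u^T)) = g u (M *m u).
Proof. by rewrite mulmxA mxtrace_mulC trace_mx11 -gE. Qed.

End Euclidean.

Section ComplexStructure.
Context {R : realType} {n : nat}.
Implicit Types v w : vec R n.
Local Notation J := (J : 'M[R]_(n.+1 + n.+1)).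

Lemma JE v : J *m v = col_mx (dsubmx v) (- usubmx v).
Proof.
rewrite -[v in LHS]vsubmxK mul_block_col.
by rewrite !mul0mx add0r addr0 mul1mx mulNmx mul1mx.
Qed.

Lemma JJ v : J *m (J *m v) = - v.
Proof.
by rewrite !JE col_mxKd col_mxKu -opp_col_mx vsubmxK.
Qed.

Lemma trJ : J^T = - J.
Proof. by rewrite /Defs.J tr_block_mx opp_block_mx !linear0 linearN /= !trmx1 ?opprK ?oppr0. Qed.

Lemma gJl v w : g (J *m v) w = - g v (J *m w).
Proof. by rewrite !gE trmx_mul trJ mulmxN mulNmx mxE mulmxA. Qed.

Lemma gJJ v w : g (J *m v) (J *m w) = g v w.
Proof. by rewrite gJl JJ gNr opprK. Qed.

Lemma gJ v : g v (J *m v) = 0.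
Proof.
by have := gJl v v; rewrite [g (J *m v) v]gC => ?; lra.
Qed.

(** The symplectic form is the complex structure paired with [g]: this is what
turns the characteristic direction into [J *m grad f z]. *)
Lemma omegaE v w : omega v w = - g v (J *m w).
Proof.
rewrite JE /g big_split_ord /= /omega -big_split -sumrN /=; apply: eq_bigr => k _.
by rewrite col_mxEu col_mxEd !mxE; ring.
Qed.

Lemma g_ge0 v : 0 <= g v v.
Proof. by apply: sumr_ge0 => i _; rewrite -expr2 sqr_ge0. Qed.

Lemma g_eq0 v : g v v = 0 -> v = 0.
Proof.
move/eqP; rewrite psumr_eq0 => [/allP v0|i _]; last by rewrite -expr2 sqr_ge0.
apply/colP => i; have := v0 i (mem_index_enum _).
by rewrite -expr2 sqrf_eq0 mxE => /eqP.
Qed.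

Lemma g_gt0 v : v != 0 -> 0 < g v v.
Proof.
by move=> v0; rewrite lt_neqAle g_ge0 andbT; apply: contra v0 => /eqP/esym/g_eq0->.
Qed.

Lemma enorm_sqr v : enorm v ^+ 2 = g v v.
Proof. by rewrite sqr_sqrtr// g_ge0. Qed.

Lemma enorm_gt0 v : v != 0 -> 0 < enorm v.
Proof. by move=> v0; rewrite sqrtr_gt0 g_gt0. Qed.

End ComplexStructure.

(** * The Hessian and sections of the distributions *)

Section Gradient.
Context {R : realType} {n : nat}.
Implicit Types (f : vec R n -> R) (z p v w : vec R n).

Lemma deriveE_grad f p v : differentiable f p -> 'D_v f p = g (grad f p) v.
Proof.
move=> df; rewrite deriveE// {1}[v]matrix_sum_delta linear_sum.
apply: eq_bigr => i _; rewrite big_ord1 linearZ /= mxE deriveE//.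
by rewrite mulrC.
Qed.

Lemma smooth_grad_coord f i : smooth_on setT f ->
  smooth_on setT (fun p => grad f p i 0).
Proof.
move=> sf; rewrite (_ : (fun p => _) = 'D_(delta_mx i 0) f).
  exact: smooth_on_derive.
by apply/funext => p; rewrite mxE.
Qed.

Lemma differentiable_grad f p : smooth_on setT f -> differentiable (grad f) p.
Proof.
move=> sf; apply: differentiable_mx => i j; rewrite (ord1 j).
exact: smooth_on_differentiable (smooth_grad_coord f i sf) _.
Qed.

Definition hess f z v w : R := 'D_v ('D_w f) z.

Definition hess_mx f z : 'M[R]_(n.+1 + n.+1) :=
  \matrix_(i, j) 'D_(delta_mx j 0) ('D_(delta_mx i 0) f) z.

Lemma hessC f z v w : smooth_on setT f -> hess f z v w = hess f z w v.
Proof. exact: derive_comm. Qed.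

Let differentiable_derive f w p : smooth_on setT f -> differentiable ('D_w f) p.
Proof.
by move=> sf; exact: smooth_on_differentiable (smooth_on_derive _ _ _ _ w sf) _.
Qed.

(** Both arguments are made linear by the symmetry of second derivatives; the
matrix form gives access to the trace of the Hessian. *)
Lemma hessE f z v w : smooth_on setT f -> hess f z v w = g v (hess_mx f z *m w).
Proof.
move=> sf; rewrite /hess deriveE_grad; last exact: differentiable_derive.
rewrite gC /g; apply: eq_bigr => i _; congr (v i 0 * _).
rewrite mxE derive_comm// deriveE_grad; last exact: differentiable_derive.
by rewrite mxE; apply: eq_bigr => j _; rewrite !mxE.
Qed.

Lemma derive_grad f z v w : smooth_on setT f ->
  g ('D_v (grad f) z) w = hess f z v w.
Proof.
move=> sf; rewrite hessC// /hess deriveE_grad; last exact: differentiable_derive.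
rewrite derive_mx; last by apply: diff_derivable; exact: differentiable_grad.
apply: eq_bigr => i _; congr (_ * w i 0).
rewrite !mxE (derive_comm _ _ _ _ _ sf).
by congr ('D_v _ z); apply/funext => p; rewrite mxE.
Qed.

Lemma derive_g (U : normedModType R) (A W : U -> vec R n) (p v : U) :
  differentiable A p -> differentiable W p ->
  differentiable (fun q => g (A q) (W q)) p /\
  'D_v (fun q => g (A q) (W q)) p = g ('D_v A p) (W p) + g (A p) ('D_v W p).
Proof.
move=> dA dW; have dc (B : U -> vec R n) i : differentiable B p ->
    differentiable (fun q => B q i 0) p.
  move=> dB; apply: (@differentiable_comp _ _ _ _ B (fun M : vec R n => M i 0)) => //.
  exact: differentiable_coord.
have -> : (fun q => g (A q) (W q)) =
    \sum_i ((fun q => A q i 0) * (fun q => W q i 0)).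
  by apply/funext => q; rewrite fct_sumE.
have dAW i : differentiable ((fun q => A q i 0) * (fun q => W q i 0)) p.
  by apply: differentiableM; exact: dc.
split; first exact: differentiable_sum.
rewrite derive_sum; last by move=> i; exact: diff_derivable.
rewrite /g -big_split /=; apply: eq_bigr => i _.
rewrite deriveM; [|by apply: diff_derivable; exact: dc..].
have eA : derivable A p v by exact: diff_derivable.
have eW : derivable W p v by exact: diff_derivable.
rewrite addrC (derive_mx eA) (derive_mx eW).
by rewrite !mxE; congr (_ + _); exact: mulrC.
Qed.

End Gradient.

Section Weingarten.
Context {R : realType} {n : nat}.
Variables (f : vec R n -> R) (z : vec R n).
Hypotheses (sf : smooth_on setT f) (fz : hypersurface f z) (gz : grad f z != 0).
Implicit Types (v w x p : vec R n) (W : vec R n -> vec R n).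

Let df p : differentiable f p.
Proof. exact: smooth_on_differentiable sf _. Qed.

Let gg0 : 0 < g (grad f z) (grad f z).
Proof. exact: g_gt0. Qed.

(** The function [g (grad f) W] vanishes on the hypersurface, hence so does its
derivative along a tangent direction; the product rule trades the derivative of
[W] for that of the gradient. The left-hand side thus depends on [W z] only,
which makes the second fundamental form and the Levi form well defined. *)
Lemma weingarten W v : differentiable W z ->
  (\near z, hypersurface f z -> tangent f z (W z)) ->
  tangent f z v ->
  g ('D_v W z) (unit_normal f z) = hess f z v (W z) / enorm (grad f z).
Proof.
move=> dW tW tv.
have [dphi phiE] := derive_g _ _ _ z v (differentiable_grad f z sf) dW.
have D0 : 'D_v (fun q => g (grad f q) (W q)) z = 0.
  apply: (tangential_derive_eq0 _ f _ z
    ((g (grad f z) (grad f z))^-1 *: grad f z) v _ (df z) dphi fz tW).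
  - by move=> p; exact: differentiable_continuous.
  - by rewrite deriveE_grad// gZr mulVf// gt_eqF.
  - by rewrite deriveE_grad.
move: D0; rewrite phiE derive_grad// => /eqP; rewrite addrC addr_eq0 => /eqP E.
by rewrite /unit_normal gNr gZr gC E mulrN opprK mulrC.
Qed.

Lemma levi_distributionE p v :
  levi_distribution f p v <-> tangent f p v /\ tangent f p (J *m v).
Proof.
split=> [[tv [u tu uv]]|[tv tJv]].
  split; first exact: tv.
  by rewrite -uv JJ /tangent /= gNr tu oppr0.
split=> //; exists (- (J *m v)); last by rewrite mulmxN JJ opprK.
by rewrite /tangent /= gNr tJv oppr0.
Qed.

Lemma levi_distribution_J p v : levi_distribution f p v ->
  levi_distribution f p (J *m v).
Proof.
move=> /levi_distributionE[tv tJv]; apply/levi_distributionE; split=> //.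
by rewrite JJ /tangent /= gNr tv oppr0.
Qed.

Let c := (g (grad f z) (grad f z))^-1.

Let smooth_coords (W : vec R n -> vec R n) :=
  forall i, smooth_on setT (fun p => W p i 0).

Let smooth_coordsW W : smooth_coords W -> smooth_on setT W.
Proof.
move=> sW; apply: smooth_on_mx => [|i j]; first exact: openT.
by rewrite (ord1 j).
Qed.

Let smooth_coordsZ (a : vec R n -> R) W : smooth_on setT a -> smooth_coords W ->
  smooth_coords (fun p => a p *: W p).
Proof.
move=> sa sW i; rewrite (_ : (fun p => _) = (fun p => a p * W p i 0)).
  by apply: smooth_onM; [exact: openT | exact: sa | exact: sW].
by apply/funext => p; rewrite mxE.
Qed.

Let smooth_coordsB V W : smooth_coords V -> smooth_coords W ->
  smooth_coords (fun p => V p - W p).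
Proof.
move=> sV sW i; rewrite (_ : (fun p => _) = (fun p => V p i 0 + - W p i 0)).
  apply: smooth_onD; [exact: openT | exact: sV |].
  by apply: smooth_onN; [exact: openT | exact: sW].
by apply/funext => p; rewrite !mxE.
Qed.

Let smooth_coords_cst v : smooth_coords (fun=> v).
Proof. by move=> i; exact: smooth_on_cst. Qed.

Let smooth_coords_grad : smooth_coords (grad f).
Proof. by move=> i; exact: smooth_grad_coord. Qed.

Let smooth_coords_Jgrad : smooth_coords (fun p => J *m grad f p).
Proof.
move=> i; rewrite (_ : (fun p => _) =
    (fun p => \sum_k (J : 'M[R]_(n.+1 + n.+1)) i k * grad f p k 0)).
  apply: smooth_on_sum => [|k]; first exact: openT.
  by apply: smooth_onM; [exact: openT | exact: smooth_on_cst |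
    exact: smooth_coords_grad].
by apply/funext => p; rewrite mxE.
Qed.

Let smooth_g (V W : vec R n -> vec R n) : smooth_coords V -> smooth_coords W ->
  smooth_on setT (fun p => g (V p) (W p)).
Proof.
move=> sV sW; apply: smooth_on_sum => [|i]; first exact: openT.
by apply: smooth_onM; [exact: openT | exact: sV | exact: sW].
Qed.

Let smooth_tangent_part v : smooth_coords
  (fun p => g (grad f p) (grad f p) *: v - g (grad f p) v *: grad f p).
Proof.
apply: smooth_coordsB; apply: smooth_coordsZ.
- exact: smooth_g smooth_coords_grad smooth_coords_grad.
- exact: smooth_coords_cst.
- exact: smooth_g smooth_coords_grad (smooth_coords_cst v).
- exact: smooth_coords_grad.
Qed.

(** The orthogonal projection of the constant [v] on the tangent space,
multiplied by the squared norm of the gradient at the point and divided by its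
value at [z]: the result is defined and smooth everywhere, also where the
gradient vanishes. *)
Lemma tangent_section v : tangent f z v ->
  exists2 W, local_section f (tangent f) z W & W z = v.
Proof.
move=> tv.
exists (fun p => c *: (g (grad f p) (grad f p) *: v - g (grad f p) v *: grad f p)).
  exists setT; split=> //; first exact: openT.
    apply: smooth_coordsW; apply: smooth_coordsZ => //; exact: smooth_on_cst.
  by move=> p _ _; rewrite /tangent /= gZr gDr gNr !gZr [_ * g _ v]mulrC subrr mulr0.
by rewrite tv scale0r subr0 scalerA mulVf ?gt_eqF// scale1r.
Qed.

(** The same projection, orthogonally to both the gradient and its image under
[J], which are orthogonal to each other and of equal norms. *)
Lemma levi_section v : levi_distribution f z v ->
  exists2 W, local_section f (levi_distribution f) z W & W z = v.
Proof.
move=> /levi_distributionE[tv tJv].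
exists (fun p => c *: (g (grad f p) (grad f p) *: v - g (grad f p) v *: grad f p
   - g (J *m grad f p) v *: (J *m grad f p))).
  exists setT; split=> //; first exact: openT.
    apply: smooth_coordsW; apply: smooth_coordsZ; first exact: smooth_on_cst.
    apply: smooth_coordsB; first exact: smooth_tangent_part.
    apply: smooth_coordsZ; last exact: smooth_coords_Jgrad.
    exact: smooth_g smooth_coords_Jgrad (smooth_coords_cst v).
  move=> p _ _; apply/levi_distributionE; split; rewrite /tangent /=.
    by rewrite gZr !gDr !gNr !gZr gJ [_ * g _ v]mulrC subrr mulr0 subr0 mulr0.
  rewrite -[g _ _]opprK -gJl gZr !gDr !gNr !gZr [g (J *m _) (grad f p)]gC gJ gJJ.
  by rewrite mulr0 subr0 [_ * g _ v]mulrC subrr mulr0 oppr0.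
rewrite tv gJl tJv oppr0 !scale0r !subr0 scalerA mulVf ?gt_eqF// scale1r.
by [].
Qed.

End Weingarten.

(** * Holomorphic vectors *)

Section ComplexVectors.
Context {R : realType} {n : nat}.
Implicit Types v w : vec R n.

Lemma sum_complex (I : Type) (r : seq I) (F G : I -> R) :
  \sum_(i <- r) (F i +i* G i) = (\sum_(i <- r) F i) +i* (\sum_(i <- r) G i).
Proof. by elim/big_rec3 : _ => [|i y1 y2 y3 _ ->]. Qed.

Lemma g_cvec v w v' w' :
  g (cvec v w) (cvec v' w') = (g v v' - g w w') +i* (g v w' + g w v').
Proof.
rewrite /g -sumrB -big_split -sum_complex; apply: eq_bigr => i _.
by rewrite !mxE /=; simpc.
Qed.

Lemma conj_holo v : conj_vec (holo v) = cvec v (J *m v).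
Proof. by apply/colP => i; rewrite !mxE /= opprK. Qed.

Lemma re_holo v : re_vec (holo v) = v.
Proof. by apply/colP => i; rewrite !mxE. Qed.

Lemma im_holo v : im_vec (holo v) = - (J *m v).
Proof. by apply/colP => i; rewrite !mxE. Qed.

Lemma re_cvec v w : re_vec (cvec v w) = v.
Proof. by apply/colP => i; rewrite !mxE. Qed.

Lemma im_cvec v w : im_vec (cvec v w) = w.
Proof. by apply/colP => i; rewrite !mxE. Qed.

Lemma re_vecD (Z W : vec R[i] n) : re_vec (Z + W) = re_vec Z + re_vec W.
Proof. by apply/colP => i; rewrite !mxE; case: (Z i 0) (W i 0) => ? ? []. Qed.

Lemma re_vec_sum (I : Type) (r : seq I) (F : I -> vec R[i] n) :
  re_vec (\sum_(i <- r) F i) = \sum_(i <- r) re_vec (F i).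
Proof.
elim/big_ind2 : _ => [|x ? y ? <- <-|//]; last exact: re_vecD.
by apply/colP => i; rewrite !mxE.
Qed.

Lemma scale_holo (a b : R) v : (a +i* b) *: holo v = holo (a *: v + b *: (J *m v)).
Proof.
rewrite /holo mulmxDr -!scalemxAr JJ; move: (J *m v) => w.
by apply/colP => i; rewrite !mxE; simpc; congr (_ +i* _); ring.
Qed.

Lemma holoD v w : holo (v + w) = holo v + holo w.
Proof.
rewrite /holo mulmxDr; move: (J *m v) (J *m w) => v' w'.
by apply/colP => i; rewrite !mxE; simpc; congr (_ +i* _); ring.
Qed.

Lemma holo0 : holo (0 : vec R n) = 0.
Proof. by apply/colP => i; rewrite /holo mulmx0 oppr0 !mxE. Qed.

(** The factor 2 comes from the real and imaginary parts of [holo v] having the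
same norm; it is why a Levi trace is half of a Riemannian one. *)
Lemma hermitian_holo v w :
  g (holo v) (conj_vec (holo w)) = (2 * g v w) +i* (2 * g v (J *m w)).
Proof.
rewrite conj_holo g_cvec !gNl gJJ gJl; congr (_ +i* _); ring.
Qed.

End ComplexVectors.

(** * The second fundamental form and the Levi form *)

Section Curvatures.
Context {R : realType} {n : nat}.
Variables (f : vec R n -> R) (z : vec R n).
Hypotheses (sf : smooth_on setT f) (fz : hypersurface f z) (gz : grad f z != 0).
Implicit Types (v w x p : vec R n) (W : vec R n -> vec R n).

Let d : vec R n := grad f z.
Let M := hess_mx f z.
Let J : 'M[R]_(n.+1 + n.+1) := J.

Let dd0 : 0 < g d d.
Proof. exact: g_gt0. Qed.

Let ddn0 : g d d != 0.
Proof. by rewrite gt_eqF. Qed.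

Lemma local_section_near (D : vec R n -> set (vec R n)) W :
  local_section f D z W ->
  differentiable W z /\ \near z, hypersurface f z -> D z (W z).
Proof.
move=> [U [oU Uz sW DW]]; split; first exact: smooth_on_differentiable sW Uz.
by apply: filterS (open_nbhs_nbhs (conj oU Uz)) => p Up; exact: DW.
Qed.

Lemma second_fundamental_formE v w : tangent f z v -> tangent f z w ->
  second_fundamental_form f z v w = hess f z v w / enorm d.
Proof.
move=> tv tw; have [V sV Vz] := tangent_section f z sf gz v tv.
have [W sW Wz] := tangent_section f z sf gz w tw.
have E V' W' : local_section f (tangent f) z W' -> V' z = v -> W' z = w ->
    g (nabla V' W' z) (unit_normal f z) = hess f z v w / enorm d.
  move=> /local_section_near[dW' tW'] V'v W'w; rewrite /nabla V'v -W'w.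
  exact: weingarten.
apply: xget_unique; first by exists V, W; split=> //; rewrite E.
by move=> _ [V' [W' [_ sW' V'z W'z ->]]]; exact: E.
Qed.

(** Expanding the two vectors [x - i Jx] and [x + i Jx] by bilinearity yields
four derivatives, each computed by [weingarten]. The imaginary part is
[hess x Jx - hess Jx x], which is zero as the Hessian is symmetric. *)
Lemma levi_formE x : levi_distribution f z x ->
  levi_form f z (holo x) (holo x) =
  ((hess f z x x + hess f z (J *m x) (J *m x)) / enorm d)%:C.
Proof.
move=> lx; have [X sX Xz] := levi_section f z sf gz x lx.
have [tx tJx] := (levi_distributionE f z x).1 lx.
have E X1 X2 : local_section f (levi_distribution f) z X2 ->
    holo (X1 z) = holo x -> holo (X2 z) = holo x ->
    g (nablaC (fun p => holo (X1 p)) (fun p => conj_vec (holo (X2 p))) z)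
      (cvec (unit_normal f z) 0) =
    ((hess f z x x + hess f z (J *m x) (J *m x)) / enorm d)%:C.
  move=> /local_section_near[dX2 lX2].
  move=> /(congr1 re_vec); rewrite !re_holo => X1z.
  move=> /(congr1 re_vec); rewrite !re_holo => X2z.
  have dJX2 : differentiable (fun p => J *m X2 p) z.
    exact: differentiable_mulmxl.
  have tX2 : \near z, hypersurface f z -> tangent f z (X2 z).
    by apply: filterS lX2 => p H /H/levi_distributionE[].
  have tJX2 : \near z, hypersurface f z -> tangent f z (J *m X2 z).
    by apply: filterS lX2 => p H /H/levi_distributionE[].
  have D1 := weingarten f z sf fz gz X2 x dX2 tX2 tx.
  have D2 := weingarten f z sf fz gz X2 (J *m x) dX2 tX2 tJx.
  have D3 := weingarten f z sf fz gz _ x dJX2 tJX2 tx.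
  have D4 := weingarten f z sf fz gz _ (J *m x) dJX2 tJX2 tJx.
  rewrite /nablaC /nabla.
  have -> : (fun q => re_vec (conj_vec (holo (X2 q)))) = X2.
    by apply/funext => q; rewrite conj_holo re_cvec.
  have -> : (fun q => im_vec (conj_vec (holo (X2 q)))) = (fun q => J *m X2 q).
    by apply/funext => q; rewrite conj_holo im_cvec.
  rewrite re_holo im_holo X1z (deriveNr _ _ _ _ _ dX2) (deriveNr _ _ _ _ _ dJX2).
  have key (a b a' b' N : vec R n) : g (cvec (a - - b) (a' - b')) (cvec N 0) =
      (g a N + g b N) +i* (g a' N - g b' N).
    by rewrite g_cvec !g0r subr0 add0r !gDl !gNl opprK.
  apply: etrans (key _ _ _ _ _) _.
  pose F (a b a' b' : R) := (a + b) +i* (a' - b').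
  apply: etrans (f_equal4 F D1 D4 D3 D2) _.
  have fin (a b a' b' c : R) : a' = b' ->
      F (a / c) (b / c) (a' / c) (b' / c) = ((a + b) / c)%:C.
    by move=> ->; rewrite /F subrr mulrDl.
  rewrite X2z; apply: fin; exact: hessC.
apply: xget_unique; first by exists X, X; split=> //; rewrite ?Xz// E// Xz.
by move=> _ [X1 [X2 [_ sX2 X1z X2z ->]]]; exact: E.
Qed.

Lemma tangent_basis : exists k (e : 'I_k -> vec R n),
  orthonormal_basis g (tangent f z) e.
Proof.
apply: (orthonormal_basis_exists idfun) => //.
- by rewrite /tangent /= gC -(scale0r 0) gZl mul0r.
- by move=> a v w tv tw; rewrite /tangent /= gDr gZr tv tw mulr0 addr0.
- move=> w _ w0; exists (enorm w)^-1.
  rewrite -[LHS]/(g _ _) gZl gZr mulrA -expr2 exprVn enorm_sqr mulVf//.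
  by rewrite gt_eqF// g_gt0.
Qed.

(** The rank one projections on the vectors of an orthonormal basis of the
tangent space add up, with the one on the normal, to the identity matrix;
multiply by the Hessian and take traces. *)
Lemma tangent_trace k (e : 'I_k -> vec R n) :
  orthonormal_basis g (tangent f z) e ->
  \sum_i g (e i) (M *m e i) = \tr M - g d (M *m d) / g d d.
Proof.
move=> [te oe se].
have idE : 1%:M = (g d d)^-1 *: (d *m d^T) + \sum_i e i *m (e i)^T.
  apply: eq_mulmx_cV => v; rewrite mul1mx mulmxDl -scalemxAl mul_outer mulmx_suml.
  have tv : tangent f z (v - (g d v / g d d) *: d).
    by rewrite /tangent /= gDr gNr gZr divfK// subrr.
  have [c cE] := se _ tv.
  have cj j : c j = g (e j) v.
    have := congr1 (g (e j)) cE.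
    rewrite gDr gNr gZr [g (e j) d]gC te mulr0 subr0 => ->.
    rewrite gC g_suml (bigD1 j)//= gZl oe eqxx mulr1 big1 ?addr0// => i ij.
    by rewrite gZl oe (negbTE ij) mulr0.
  apply: etrans (esym (subrK ((g d v / g d d) *: d) v)) _.
  rewrite cE [LHS]addrC; congr (_ + _); first by rewrite scalerA mulrC (gC v).
  by apply: eq_bigr => j _; rewrite mul_outer cj gC.
have -> : \tr M = g d (M *m d) / g d d + \sum_i g (e i) (M *m e i).
  rewrite -[in LHS](mulmx1 M) idE mulmxDr mxtraceD -scalemxAr mxtraceZ.
  rewrite mxtrace_outer mulrC mulmx_sumr raddf_sum; congr (_ + _).
  by apply: eq_bigr => i _; exact: mxtrace_outer.
by rewrite addrAC subrr add0r.
Qed.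

Lemma mean_curvatureE : (2 * n + 1)%:R * mean_curvature f z =
  (\tr M - g d (M *m d) / g d d) / enorm d.
Proof.
rewrite /mean_curvature mulrA mulfV ?mul1r; last by rewrite pnatr_eq0 addn1.
apply: trace_wrtE; first exact: tangent_basis.
move=> k e be; rewrite -(tangent_trace k e be) mulr_suml; apply: eq_bigr => i _.
have [te _ _] := be.
by rewrite second_fundamental_formE ?hessE.
Qed.

End Curvatures.

(** * Levi mean curvature and characteristic curvature *)

Section LeviAndCharacteristic.
Context {R : realType} {n : nat}.
Variables (f : vec R n -> R) (z : vec R n).
Hypotheses (sf : smooth_on setT f) (fz : hypersurface f z) (gz : grad f z != 0).
Implicit Types (v w x p : vec R n) (W : vec R n -> vec R n).

Let d : vec R n := grad f z.
Let M := hess_mx f z.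
Local Notation J := (Defs.J : 'M[R]_(n.+1 + n.+1)).

Let dd0 : 0 < g d d.
Proof. exact: g_gt0. Qed.

Let ddn0 : g d d != 0.
Proof. by rewrite gt_eqF. Qed.

Lemma holo_tangentE (Z : vec R[i] n) : holo_tangent f z Z ->
  levi_distribution f z (re_vec Z) /\ Z = holo (re_vec Z).
Proof. by move=> [v lv <-]; rewrite re_holo. Qed.

Lemma levi_distributionD v w : levi_distribution f z v ->
  levi_distribution f z w -> levi_distribution f z (v + w).
Proof.
move=> /levi_distributionE[tv tJv] /levi_distributionE[tw tJw].
apply/levi_distributionE; rewrite mulmxDr /tangent /= !gDr.
by rewrite tv tw tJv tJw addr0.
Qed.

Lemma levi_distributionZ a v : levi_distribution f z v ->
  levi_distribution f z (a *: v).
Proof.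
move=> /levi_distributionE[tv tJv]; apply/levi_distributionE.
by rewrite -scalemxAr /tangent /= !gZr tv tJv mulr0.
Qed.

Lemma holo_tangent_basis : exists k (e : 'I_k -> vec R[i] n),
  orthonormal_basis (fun Z Z' : vec R[i] n => g Z (conj_vec Z')) (holo_tangent f z) e.
Proof.
have -> : (fun Z Z' : vec R[i] n => g Z (conj_vec Z')) =
    (fun Z Z' : vec R[i] n => \sum_i Z i 0 * conjc (Z' i 0)).
  by apply/funext => Z; apply/funext => Z'; apply: eq_bigr => i _; rewrite mxE.
apply: (orthonormal_basis_exists (conjc : {rmorphism R[i] -> R[i]})).
- exact: conjcK.
- exists 0; last exact: holo0.
  by apply/levi_distributionE; rewrite mulmx0 /tangent /= g0r.
- move=> [a b] _ _ [v lv <-] [w lw <-].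
  exists (a *: v + b *: (J *m v) + w); last by rewrite holoD scale_holo.
  apply: levi_distributionD => //; apply: levi_distributionD; apply: levi_distributionZ => //.
  exact: levi_distribution_J.
- move=> _ [v _ <-] v0; exists ((Num.sqrt (2 * g v v))^-1)%:C.
  have gv : 0 < 2 * g v v.
    by rewrite mulr_gt0// g_gt0//; apply: contraNneq v0 => ->; rewrite holo0.
  have E : g (holo v) (conj_vec (holo v)) = (2 * g v v)%:C.
    by rewrite hermitian_holo gJ mulr0.
  set a : R[i] := _%:C.
  have aR : conjc a = a by exact: conjc_real.
  have aM (y : R[i]) : conjc (a * y) = a * conjc y.
    by rewrite -[in RHS]aR; exact: rmorphM.
  have -> : \sum_i (a *: holo v) i 0 * conjc ((a *: holo v) i 0) =
      a * a * g (holo v) (conj_vec (holo v)).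
    rewrite /g mulr_sumr; apply: eq_bigr => i _; rewrite mxE [conj_vec _ _ _]mxE.
    by rewrite aM mulrACA.
  rewrite E -!rmorphM /= -expr2 exprVn sqr_sqrtr; last exact: ltW.
  by rewrite mulVf// gt_eqF.
Qed.

(** Likewise, the real and imaginary parts of a unitary basis [holo (X i)]
decompose the Levi distribution. As [X i] has squared norm 1/2, the projection
on it is twice [X i *m (X i)^T], whence the factor 2; the two missing
directions are the normal and its image under [J]. *)
Lemma holo_tangent_trace k (e : 'I_k -> vec R[i] n) :
  orthonormal_basis (fun Z Z' : vec R[i] n => g Z (conj_vec Z')) (holo_tangent f z) e ->
  2 * \sum_i (g (re_vec (e i)) (M *m re_vec (e i)) +
              g (J *m re_vec (e i)) (M *m (J *m re_vec (e i)))) =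
  \tr M - g d (M *m d) / g d d - g (J *m d) (M *m (J *m d)) / g d d.
Proof.
move=> [te oe se]; pose X i := re_vec (e i).
have lX i : tangent f z (X i) /\ tangent f z (J *m X i).
  by have [/levi_distributionE] := holo_tangentE _ (te i).
have eX i : e i = holo (X i) by have [] := holo_tangentE _ (te i).
pose Jd := J *m d.
pose P := \sum_i (X i *m (X i)^T + (J *m X i) *m (J *m X i)^T).
have frame v : levi_distribution f z v ->
    v = \sum_i (2 * g v (X i) *: X i + 2 * g v (J *m X i) *: (J *m X i)).
  move=> lv; have [|c cE] := se (holo v); first by exists v.
  have cj j : c j = (2 * g v (X j)) +i* (2 * g v (J *m X j)).
    rewrite -hermitian_holo -eX cE g_suml (bigD1 j)//= gZl oe eqxx mulr1.
    by rewrite big1 ?addr0// => i ij; rewrite gZl oe (negbTE ij) mulr0.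
  rewrite -[LHS]re_holo cE re_vec_sum; apply: eq_bigr => i _.
  by rewrite cj eX scale_holo re_holo.
have idE : 1%:M = (g d d)^-1 *: (d *m d^T) + (g d d)^-1 *: (Jd *m Jd^T) + 2 *: P.
  apply: eq_mulmx_cV => v; rewrite mul1mx !mulmxDl -!scalemxAl !mul_outer.
  rewrite !scalerA.
  pose v' := v - ((g d d)^-1 * g v d *: d + (g d d)^-1 * g v Jd *: Jd).
  have lv' : levi_distribution f z v'.
    apply/levi_distributionE; split; rewrite /tangent /= -/d.
      by rewrite gDr gNr gDr !gZr gJ mulr0 addr0 mulrAC mulVf// mul1r gC subrr.
    rewrite -[LHS]opprK -gJl -/Jd gDr gNr gDr !gZr.
    by rewrite [g Jd d]gC gJ mulr0 add0r gJJ mulrAC mulVf// mul1r gC subrr oppr0.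
  have gX x : tangent f z x -> tangent f z (J *m x) -> g v' x = g v x.
    move=> tx tJx; rewrite /v' gDl gNl gDl !gZl gJl tx tJx.
    by rewrite oppr0 !mulr0 addr0 subr0.
  rewrite -[LHS](subrK ((g d d)^-1 * g v d *: d + (g d d)^-1 * g v Jd *: Jd)) -/v'.
  rewrite [LHS]addrC; congr (_ + _); rewrite (frame _ lv') mulmx_suml scaler_sumr.
  apply: eq_bigr => i _; have [tX tJX] := lX i.
  rewrite mulmxDl !mul_outer scalerDr !scalerA !gX//.
  by rewrite JJ /tangent /= gNr tX oppr0.
have -> : \tr M = g d (M *m d) / g d d + g Jd (M *m Jd) / g d d +
    2 * \sum_i (g (X i) (M *m X i) + g (J *m X i) (M *m (J *m X i))).
  rewrite -[in LHS](mulmx1 M) idE !mulmxDr !mxtraceD -!scalemxAr !mxtraceZ.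
  rewrite !mxtrace_outer ![_^-1 * _]mulrC; congr (_ + 2 * _).
  rewrite mulmx_sumr raddf_sum; apply: eq_bigr => i _.
  by rewrite mulmxDr raddfD; congr (_ + _); exact: mxtrace_outer.
by rewrite -!/Jd; ring.
Qed.

Lemma levi_mean_curvatureE : (1 <= n)%N -> (2 * n)%:R * levi_mean_curvature f z =
  ((\tr M - g d (M *m d) / g d d - g (J *m d) (M *m (J *m d)) / g d d) / enorm d)%:C.
Proof.
move=> n1; rewrite /levi_mean_curvature.
rewrite (trace_wrtE _ _ _ _ _ (((\tr M - g d (M *m d) / g d d -
    g (J *m d) (M *m (J *m d)) / g d d) / 2 / enorm d)%:C)).
- rewrite natrM -mulrA mulVKf; last by rewrite pnatr_eq0 -lt0n.
  rewrite -(rmorph_nat (real_complex R) 2) -rmorphM; congr (_%:C).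
  by rewrite mulrA [2 * _]mulrC divfK// pnatr_eq0.
- exact: holo_tangent_basis.
- move=> k e be; rewrite -(holo_tangent_trace k e be).
  rewrite [2 * _]mulrC mulfK ?pnatr_eq0// mulr_suml rmorph_sum.
  have [te _ _] := be; apply: eq_bigr => i _.
  have [li eiE] := holo_tangentE _ (te i).
  by rewrite [in LHS]eiE levi_formE// !hessE.
Qed.

(** The normal line is the orthogonal complement of the tangent space. *)
Lemma tangent_orthogonal u : (forall v, tangent f z v -> g v u = 0) ->
  u = (g d u / g d d) *: d.
Proof.
move=> H; apply/eqP; rewrite -subr_eq0; apply/eqP; apply: g_eq0.
have t : tangent f z (u - (g d u / g d d) *: d).
  by rewrite /tangent /= gDr gNr gZr divfK// subrr.
set w := u - _ in t *.
by rewrite {2}/w gDr gNr gZr H// [g w d]gC t mulr0 subr0.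
Qed.

(** A vector [xi] is characteristic when [J *m xi] is orthogonal to the
tangent space, that is, normal. *)
Lemma characteristic_spaceE xi : characteristic_space f z xi <->
  exists a, xi = a *: (J *m d).
Proof.
split=> [[txi oxi]|[a ->]].
  have H v : tangent f z v -> g v (J *m xi) = 0.
    by move=> /oxi; rewrite omegaE => /eqP; rewrite oppr_eq0 => /eqP.
  exists (- (g d (J *m xi) / g d d)).
  rewrite scaleNr scalemxAr -(tangent_orthogonal _ H) JJ opprK.
  by [].
split=> [|v tv]; first by rewrite /tangent /= gZr gJ mulr0.
by rewrite omegaE -scalemxAr JJ gZr gNr gC tv oppr0 mulr0 oppr0.
Qed.

(** Differentiate [f (c t) = 0] twice: the normal acceleration of a curve in
the hypersurface depends on its velocity only, through the Hessian. *)
Lemma curve_acceleration (e : R) (c : R -> vec R n) : 0 < e ->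
  smooth_on `]- e, e[%classic c ->
  (forall t, t \in `]- e, e[ -> hypersurface f (c t)) -> c 0 = z ->
  g (c^`(2)%classic 0) (unit_normal f z) =
  hess f z (c^`()%classic 0) (c^`()%classic 0) / enorm d.
Proof.
move=> e0 sc fc cz; pose I := `]- e, e[%classic : set R.
have oI : open I by exact: interval_open.
have I0 : I 0 by rewrite /I /= in_itv/= oppr_lt0 e0.
have DE : c^`()%classic = 'D_1 c by apply/funext => t; exact: derive1E.
rewrite derive1nS derive1n1 DE derive1E.
have df p : differentiable f p by exact: smooth_on_differentiable sf _.
have dc (t : R) : I t -> differentiable c t by exact: smooth_on_differentiable sc.
have dDc : differentiable ('D_1 c) 0.
  exact: smooth_on_differentiable (smooth_on_derive _ _ _ _ (1 : R) sc) I0.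
have dgr := differentiable_grad f (c 0) sf.
have psi0 (t : R) : I t -> g (grad f (c t)) ('D_1 c t) = 0.
  move=> It; rewrite -deriveE_grad//.
  have [_ <-] := is_derive_comp_curve _ _ c f t (dc t It) (df (c t)).
  rewrite -[RHS](derive_cst (0 : R) t (1 : R)); apply: near_eq_derive.
  by apply: (open_near_eq oI) It => q; exact: fc.
have [_ psiE] := derive_g _ (grad f \o c) ('D_1 c) 0 (1 : R)
  (differentiable_comp (dc 0 I0) dgr) dDc.
have [_ AE] := is_derive_comp_curve _ _ c (grad f) 0 (dc 0 I0) dgr.
have D0 : 'D_1 (fun t => g ((grad f \o c) t) ('D_1 c t)) 0 = 0.
  rewrite -[RHS](derive_cst (0 : R) (0 : R) (1 : R)); apply: near_eq_derive.
  exact: (open_near_eq oI) I0.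
have hE : g ('D_1 (grad f \o c) 0) ('D_1 c 0) = hess f z ('D_1 c 0) ('D_1 c 0).
  by apply: etrans (congr1 (g ^~ _) AE) _; rewrite cz; exact: derive_grad.
have opp (a b b' : R) : a + b = 0 -> a = b' -> b = - b' by move=> ab <-; lra.
have := opp _ _ _ (etrans (esym psiE) D0) hE; rewrite /= cz => E.
by rewrite /unit_normal gNr gZr gC E mulrN opprK mulrC.
Qed.

(** Every characteristic velocity is a multiple of [J *m grad f z], and the
quotient by its squared norm removes the multiple; [level_curve] provides one
such curve, along which the value is attained. *)
Lemma characteristic_curvatureE : characteristic_curvature f z =
  g (J *m d) (M *m (J *m d)) / g d d / enorm d.
Proof.
have Jd0 : 0 < g (J *m d) (J *m d) by rewrite gJJ.
have E c : characteristic_curve f z c ->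
    g (c^`(2)%classic 0) (unit_normal f z) / enorm (c^`()%classic 0) ^+ 2 =
    g (J *m d) (M *m (J *m d)) / g d d / enorm d.
  move=> [e e0 [sc fc cz /characteristic_spaceE[a cE] c0]].
  rewrite (curve_acceleration e c)// enorm_sqr; move: c0; rewrite cE => c0.
  have a0 : a != 0 by apply: contraNneq c0 => ->; rewrite scale0r.
  rewrite hessE// -scalemxAr !gZl !gZr gJJ; field.
  by rewrite a0 ddn0 gt_eqF// enorm_gt0.
have fd : 'D_d f z = g d d.
  by rewrite deriveE_grad//; exact: smooth_on_differentiable sf _.
have fJd : 'D_(J *m d) f z = 0.
  by rewrite deriveE_grad ?gJ//; exact: smooth_on_differentiable sf _.
have [|e [c [e0 sc fc cz cE]]] := level_curve _ _ f z (J *m d) d sf fz.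
  by rewrite fd.
have cc : characteristic_curve f z c.
  exists e => //; split=> //; rewrite derive1E cE fJd mul0r scale0r subr0.
    by apply/characteristic_spaceE; exists 1; rewrite scale1r.
  by apply: contraTneq Jd0 => ->; rewrite g0r ltxx.
apply: xget_unique; first by exists c; rewrite E.
by move=> _ [c' [cc' ->]]; exact: E.
Qed.

End LeviAndCharacteristic.

Theorem mainTheorem1 (R : realType) (n : nat) (f : vec R n -> R) :
  (1 <= n)%N ->
  smooth_on [set: vec R n] f ->
  hypersurface f
    = closure [set z | f z < 0] `\` interior [set z | f z < 0] ->
  (forall z, hypersurface f z -> grad f z != 0) ->
  forall z, hypersurface f z ->
    ((2 * n + 1)%:R * mean_curvature f z)%:C
    = (2 * n)%:R * levi_mean_curvature f z + (characteristic_curvature f z)%:C.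
Proof.
move=> n1 sf _ gradn0 z fz; have gz := gradn0 z fz.
rewrite mean_curvatureE// levi_mean_curvatureE// characteristic_curvatureE//.
by rewrite -rmorphD /= -mulrDl subrK.
Qed.
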